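(* Let $X$ be an infinite-dimensional real Banach space, $B_X$ its closed unit ball, and $p\in\{1,2,\dots\}\cup\{\infty\}$. The following assertions are equivalent: (1) $X$ has a $C^p$ smooth bump function. (2) There exist a nonempty contractible closed subset $D\subseteq B_X$ and a $C^p$ diffeomorphism $f:X\to X\setminus D$ such that $f(x)=x$ for all $x\in X\setminus B_X$.
   Context: A bump function on $X$ is a function $b:X\to\mathbb{R}$ which is not identically zero and has bounded support, where $\operatorname{supp} b=\overline{\{x\in X: b(x)\neq 0\}}$. A $C^p$ diffeomorphism $f:X\to X\setminus D$ is a bijection which is $C^p$ smooth (Fréchet sense) with $C^p$ smooth inverse, $X\setminus D$ being an open subset of $X$. *)

(* Defs.v *)
From HB Require Import structures.
From mathcomp Require Import all_boot all_order all_algebra.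
From mathcomp Require Import all_classical all_reals all_analysis.
Set Implicit Arguments. Unset Strict Implicit. Unset Printing Implicit Defensive.
Import Order.TTheory GRing.Theory Num.Theory.
Import numFieldNormedType.Exports.
Local Open Scope classical_set_scope.
Local Open Scope ring_scope.

(* Higher Fréchet derivatives are represented concretely: the j-th derivative
   of f at x is a bounded j-linear map, encoded as a function
   (nat -> V) -> W that only depends on the first j arguments. *)

(* smoothness order p in {1,2,...} u {oo}: Some n = n, None = infinity *)
Definition ord_le (j : nat) (p : option nat) : Prop :=
  match p with None => True | Some n => (j <= n)%N end.

Definition vcons {V : Type} (h : V) (v : nat -> V) : nat -> V :=
  fun n => match n with O => h | S m => v m end.

Definition vupd {V : Type} (v : nat -> V) (i : nat) (y : V) : nat -> V :=
  fun n => if n == i then y else v n.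

Section Multi.
Context {R : realType} {V W : normedModType R}.

Definition bounded_multilinear (j : nat) (A : (nat -> V) -> W) : Prop :=
  [/\ (forall v w, (forall i, (i < j)%N -> v i = w i) -> A v = A w),
      (forall i, (i < j)%N -> forall (v : nat -> V) (a : R) (y z : V),
          A (vupd v i (a *: y + z)) = a *: A (vupd v i y) + A (vupd v i z))
    & exists M : R, forall v, `|A v| <= M * \prod_(i < j) `|v i| ].

Definition frechet_derivs (p : option nat) (U : set V) (f : V -> W)
    (D : nat -> V -> (nat -> V) -> W) : Prop :=
  forall x, U x ->
  [/\ (forall v, D 0%N x v = f x),
      (forall j, ord_le j p -> bounded_multilinear j (D j x)),
      (forall j, ord_le j.+1 p -> forall e : R, 0 < e ->
          \forall h \near (0 : V), forall v,
            `|D j (x + h) v - D j x v - D j.+1 x (vcons h v)|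
              <= e * `|h| * \prod_(i < j) `|v i|)
    & (forall j, ord_le j p -> forall e : R, 0 < e ->
          \forall y \near x, forall v,
            `|D j y v - D j x v| <= e * \prod_(i < j) `|v i|) ].

Definition Cp_on (p : option nat) (U : set V) (f : V -> W) : Prop :=
  exists D, frechet_derivs p U f D.

End Multi.

Section Defs.
Context {R : realType} {X : normedModType R}.

Definition infinite_dimensional : Prop :=
  forall (n : nat) (e : 'I_n -> X),
    exists x : X, ~ exists c : 'I_n -> R, x = \sum_(i < n) c i *: e i.

Definition support (b : X -> R) : set X := closure [set x | b x != 0].

Definition is_bump (b : X -> R) : Prop :=
  (exists x, b x != 0) /\ exists M : R, forall x, support b x -> `|x| <= M.

Definition has_Cp_bump (p : option nat) : Prop :=
  exists b : X -> R^o, is_bump b /\ Cp_on p setT b.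

Definition contractible (D : set X) : Prop :=
  exists (x0 : X) (H : X -> R -> X),
    [/\ D x0,
        {within D `*` `[0, 1], continuous (fun q : X * R => H q.1 q.2)},
        (forall x t, D x -> `[0, 1]%classic t -> D (H x t)),
        (forall x, D x -> H x 0 = x)
      & (forall x, D x -> H x 1 = x0)].

Definition Cp_diffeo_onto_compl (p : option nat) (D : set X) (f : X -> X) : Prop :=
  [/\ forall x, ~ D (f x),
      Cp_on p setT f
    & exists g : X -> X,
        [/\ forall x, g (f x) = x,
            forall y, ~ D y -> f (g y) = y
          & Cp_on p (~` D) g]].

End Defs.

(* Main.v *)
(* From (2) to (1): [f] is not the identity, so a functional norming
   [f d - d] composed with [f - id] is a bump function.

   From (1) to (2): the deleted set [D] is an embedded half-open curve (a ray)
   inside the unit ball that never converges.  Choose unit vectors [e n] and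
   norm-one functionals [l n] with [l n (e n) = 1] and [l m (e n) = 0] for
   [m < n], and a smooth curve [gam] that runs through small multiples of
   [e 1], [e 2], ...; then [gam t] has no limit as [t] grows.  Let [l] be a multiple of [l 0] with [l v = 1].  On the
   open half-space [l > 0], the substitution [s = 1 / t] and a shear by [gam]
   map the straight half-line [{t v : t >= 1}] to [D], and a thin cylinder
   around the half-line to a tube around [D] which is closed in the whole space,
   so that whatever is the identity off the tube extends by the identity.
   It remains to delete the half-line.  With a bump [b] normalized by [b 0 = 1],
   the map [w |-> w + N w v], where
     [N (y + t v) = \sum_n b ((n + 1) y) * theta_n t],
   is a bijection from the complement of the half-line onto the half-space as
   soon as the [theta_n] are smooth, nondecreasing, supported in
   [t > 1 - 1 / (n + 2)], with a sum that blows up at [1].  Off the half-line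
   the sum is locally finite: either [y <> 0], and the [b ((n + 1) y)] vanish,
   or [t < 1], and the [theta_n t] vanish.  No bound on the derivatives of [b]
   is needed.  The inverse moves each point along [v] by the solution of a
   scalar equation which is monotone, hence it is as smooth as [b].

   Higher derivatives are handled by iterating the Frechet derivative with
   values in spaces of bounded operators. *)

Require Import Defs.
From HB Require Import structures.
From mathcomp Require Import all_boot all_order all_algebra.
From mathcomp Require Import all_classical all_reals all_analysis.
From mathcomp Require Import ring lra.
Set Implicit Arguments. Unset Strict Implicit. Unset Printing Implicit Defensive.
Import Order.TTheory GRing.Theory Num.Theory.
Import numFieldNormedType.Exports.
Local Open Scope classical_set_scope.
Local Open Scope ring_scope.

(** * Bounded operators *)

(** Bundled with a bound so that operators again form a normed space. Derivatives can then be
    differentiated in turn, and equality is pointwise by proof irrelevance. *)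
Record bop (R : realType) (V W : normedModType R) := Bop {
  bop_fun :> V -> W;
  bop_lin : linear bop_fun;
  bop_bnd : exists M : R, forall x, `|bop_fun x| <= M * `|x| }.

Section Bop.
Context {R : realType} {V W : normedModType R}.
Implicit Types A B : bop V W.

Lemma bop_eq A B : (forall x, A x = B x) -> A = B.
Proof.
case: A B => [f fl fb] [g gl gb] /= /funext fg; rewrite -fg in gl gb *.
by congr Bop; exact: Prop_irrelevance.
Qed.

Lemma bopD A x y : A (x + y) = A x + A y.
Proof. by have := bop_lin A 1 x y; rewrite !scale1r. Qed.

Lemma bop0 A : A 0 = 0.
Proof. by apply: (addrI (A 0)); rewrite -bopD !addr0. Qed.

Lemma bopZ A a x : A (a *: x) = a *: A x.
Proof. by have := bop_lin A a x 0; rewrite !addr0 bop0 addr0. Qed.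

Lemma bopN A x : A (- x) = - A x.
Proof. by rewrite -scaleN1r bopZ scaleN1r. Qed.

Lemma bopB A x y : A (x - y) = A x - A y.
Proof. by rewrite bopD bopN. Qed.

Lemma linear_bound_ge0 (f : V -> W) :
  (exists M : R, forall x, `|f x| <= M * `|x|) ->
  exists2 M : R, 0 <= M & forall x, `|f x| <= M * `|x|.
Proof.
move=> [M fM]; exists `|M| => // x.
by apply: (le_trans (fM x)); rewrite ler_wpM2r// ler_norm.
Qed.

Let zero_lin : linear (fun _ : V => 0 : W).
Proof. by move=> a x y; rewrite scaler0 addr0. Qed.
Let zero_bnd : exists M : R, forall x : V, `|0 : W| <= M * `|x|.
Proof. by exists 0 => x; rewrite normr0 mul0r. Qed.
Definition bop_zero := Bop zero_lin zero_bnd.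

Let opp_lin A : linear (fun x => - A x).
Proof. by move=> a x y; rewrite bopD bopZ opprD scalerN. Qed.
Let opp_bnd A : exists M : R, forall x : V, `|- A x| <= M * `|x|.
Proof. by have [M AM] := bop_bnd A; exists M => x; rewrite normrN. Qed.
Definition bop_opp A := Bop (opp_lin A) (opp_bnd A).

Let add_lin A B : linear (fun x => A x + B x).
Proof. by move=> a x y; rewrite !bopD !bopZ scalerDr addrACA. Qed.
Let add_bnd A B : exists M : R, forall x : V, `|A x + B x| <= M * `|x|.
Proof.
have [M AM] := bop_bnd A; have [N BN] := bop_bnd B; exists (M + N) => x.
by rewrite (le_trans (ler_normD _ _))// mulrDl lerD.
Qed.
Definition bop_add A B := Bop (add_lin A B) (add_bnd A B).

Let scale_lin c A : linear (fun x => c *: A x).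
Proof.
by move=> a x y; rewrite bopD bopZ scalerDr !scalerA (mulrC c).
Qed.
Let scale_bnd c A : exists M : R, forall x : V, `|c *: A x| <= M * `|x|.
Proof.
have [M AM] := bop_bnd A; exists (`|c| * M) => x.
by rewrite normrZ -mulrA ler_wpM2l.
Qed.
Definition bop_scale c A := Bop (scale_lin c A) (scale_bnd c A).

HB.instance Definition _ := gen_eqMixin (bop V W).
HB.instance Definition _ := gen_choiceMixin (bop V W).

Let bop_addA : associative bop_add.
Proof. by move=> A B C; apply: bop_eq => x /=; rewrite addrA. Qed.
Let bop_addC : commutative bop_add.
Proof. by move=> A B; apply: bop_eq => x /=; rewrite addrC. Qed.
Let bop_add0 : left_id bop_zero bop_add.
Proof. by move=> A; apply: bop_eq => x /=; rewrite add0r. Qed.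
Let bop_addN : left_inverse bop_zero bop_opp bop_add.
Proof. by move=> A; apply: bop_eq => x /=; rewrite addNr. Qed.
HB.instance Definition _ :=
  GRing.isZmodule.Build (bop V W) bop_addA bop_addC bop_add0 bop_addN.

Let bop_scaleA a b A : bop_scale a (bop_scale b A) = bop_scale (a * b) A.
Proof. by apply: bop_eq => x /=; rewrite scalerA. Qed.
Let bop_scale1 : left_id 1 bop_scale.
Proof. by move=> A; apply: bop_eq => x /=; rewrite scale1r. Qed.
Let bop_scaleDr : right_distributive bop_scale +%R.
Proof. by move=> a A B; apply: bop_eq => x /=; rewrite scalerDr. Qed.
Let bop_scaleDl A : {morph bop_scale^~ A : a b / a + b}.
Proof. by move=> a b; apply: bop_eq => x /=; rewrite scalerDl. Qed.
HB.instance Definition _ := GRing.Zmodule_isLmodule.Build R (bop V W)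
  bop_scaleA bop_scale1 bop_scaleDr bop_scaleDl.

Definition opnorm A : R :=
  inf [set M | 0 <= M /\ forall x, `|A x| <= M * `|x|].

Let bounds_neq0 A : [set M | 0 <= M /\ forall x, `|A x| <= M * `|x|] !=set0.
Proof. by have [M M0 AM] := linear_bound_ge0 (bop_bnd A); exists M. Qed.

Lemma opnorm_ge0 A : 0 <= opnorm A.
Proof. by apply: lb_le_inf => // M []. Qed.

Lemma opnorm_le A M : 0 <= M -> (forall x, `|A x| <= M * `|x|) -> opnorm A <= M.
Proof. by move=> M0 AM; apply: ge_inf => //; exists 0 => N []. Qed.

(** The infimum is attained: for [x != 0], the quotient of [|A x|] by [|x|] is below every
    admissible constant. *)
Lemma le_opnorm A x : `|A x| <= opnorm A * `|x|.
Proof.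
have [->|x0] := eqVneq x 0; first by rewrite bop0 !normr0 mulr0.
rewrite -ler_pdivrMr ?normr_gt0//; apply: lb_le_inf => // M [_ AM].
by rewrite ler_pdivrMr ?normr_gt0.
Qed.

Let opnormD A B : opnorm (A + B) <= opnorm A + opnorm B.
Proof.
apply: opnorm_le => [|x]; first by rewrite addr_ge0 ?opnorm_ge0.
by rewrite (le_trans (ler_normD _ _))// mulrDl lerD ?le_opnorm.
Qed.
Let opnormZ_le c A : opnorm (c *: A) <= `|c| * opnorm A.
Proof.
apply: opnorm_le => [|x]; first by rewrite mulr_ge0 ?opnorm_ge0.
by rewrite normrZ -mulrA ler_wpM2l ?le_opnorm.
Qed.
Let opnormZ c A : opnorm (c *: A) = `|c| * opnorm A.
Proof.
apply/eqP; rewrite eq_le opnormZ_le/=.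
have [->|c0] := eqVneq c 0; first by rewrite normr0 mul0r opnorm_ge0.
rewrite -ler_pdivlMl ?normr_gt0// -normfV.
by rewrite (le_trans _ (opnormZ_le _ _))// scalerA mulVf// scale1r.
Qed.
Let opnorm_eq0 A : opnorm A = 0 -> A = 0.
Proof.
move=> A0; apply: bop_eq => x; apply/normr0_eq0/eqP.
by rewrite eq_le normr_ge0 andbT (le_trans (le_opnorm A x))// A0 mul0r.
Qed.
HB.instance Definition _ := Lmodule_isNormed.Build R (bop V W)
  opnormD opnormZ opnorm_eq0.

Lemma bop_norm A x : `|A x| <= `|A| * `|x|.
Proof. exact: le_opnorm. Qed.

Lemma bop_norm_le A M : 0 <= M -> (forall x, `|A x| <= M * `|x|) -> `|A| <= M.
Proof. exact: opnorm_le. Qed.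

Lemma bop_addE A B x : (A + B) x = A x + B x. Proof. by []. Qed.
Lemma bop_oppE A x : (- A) x = - A x. Proof. by []. Qed.
Lemma bop_scaleE c A x : (c *: A) x = c *: A x. Proof. by []. Qed.
Lemma bop_zeroE x : (0 : bop V W) x = 0. Proof. by []. Qed.
Definition bopE := (bop_addE, bop_oppE, bop_scaleE, bop_zeroE).

End Bop.

(** * First Fréchet derivatives *)

Lemma near_normP (R : realType) (V : normedModType R) (x : V) (P : set V) :
  nbhs x P -> exists2 d : R, 0 < d & forall y, `|y - x| < d -> P y.
Proof.
move=> /nbhs_ballP [d /= d0 dP]; exists d => // y yx; apply: dP.
by rewrite -ball_normE /= distrC.
Qed.

Lemma near_norm (R : realType) (V : normedModType R) (x : V) (P : set V) (d : R) :
  0 < d -> (forall y, `|y - x| < d -> P y) -> nbhs x P.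
Proof.
move=> d0 dP; apply/nbhs_ballP; exists d => //= y.
by rewrite -ball_normE /= distrC => /dP.
Qed.

Lemma near_dist (R : realType) (V : normedModType R) (x : V) (d : R) :
  0 < d -> \forall y \near x, `|y - x| < d.
Proof. by move=> d0; apply: (near_norm d0). Qed.

Section FrechetDerivative.
Context {R : realType} {V W : normedModType R}.
Implicit Types (f g : V -> W) (A B : bop V W) (x : V).

Definition fder f x A := forall e : R, 0 < e ->
  \forall y \near x, `|f y - f x - A (y - x)| <= e * `|y - x|.

(** Lets the estimates for sums, compositions and products end with any fixed multiple of [e].
    Dividing by [|K| + 1] also covers [K <= 0]. *)
Lemma fder_bigO f x A : (exists K, forall e : R, 0 < e ->
  \forall y \near x, `|f y - f x - A (y - x)| <= K * e * `|y - x|) -> fder f x A.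
Proof.
move=> [K fK] e e0; have K0 : 0 < `|K| + 1 by rewrite ltr_pwDr.
have := fK _ (divr_gt0 e0 K0); apply: filterS => y /le_trans; apply.
rewrite ler_wpM2r// mulrCA ler_piMr ?(ltW e0)// ler_pdivrMr// mul1r.
by rewrite (le_trans (ler_norm K))// lerDl.
Qed.

Lemma fder_unique f x A B : fder f x A -> fder f x B -> A = B.
Proof.
move=> fA fB; apply/eqP; rewrite -subr_eq0 -normr_le0; apply/ler_addgt0Pr => e e0.
rewrite add0r; have e20 : 0 < e / 2 by rewrite divr_gt0.
have [d d0 Hd] := near_normP (filterI (fA _ e20) (fB _ e20)).
apply: bop_norm_le => [|h]; first exact: ltW.
have [->|h0] := eqVneq h 0; first by rewrite bop0 !normr0 mulr0.
have nh0 : 0 < `|h| by rewrite normr_gt0.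
(* Scaled so that [c *: h] has norm [d / 2]. The bound obtained there is homogeneous in [h], so it
   holds for [h] itself. *)
pose c := d / (2 * `|h|).
have c0 : 0 < c by rewrite divr_gt0// mulr_gt0.
have [|] := Hd (x + c *: h).
  rewrite addrAC subrr add0r normrZ gtr0_norm// /c invfM mulrA mulfVK ?gt_eqF//.
  by rewrite ltr_pdivrMr// ltr_pMr// ltr1n.
rewrite (addrC x) addrK => H1 H2.
rewrite -(@ler_pM2l _ c)// -[X in X * _ <= _](gtr0_norm c0) -normrZ -bopZ.
rewrite bopE bop_oppE.
have -> : A (c *: h) - B (c *: h) = (f (c *: h + x) - f x - B (c *: h)) -
   (f (c *: h + x) - f x - A (c *: h)).
  by rewrite opprB [RHS]addrC addrA subrK.
rewrite (le_trans (ler_normB _ _))//.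
rewrite normrZ gtr0_norm// in H1 H2; lra.
Qed.

Lemma fder_cvg f x A : fder f x A -> f y @[y --> x] --> f x.
Proof.
move=> fA; apply/cvgrPdist_le => e e0; near=> y.
have H : `|f y - f x - A (y - x)| <= 1 * `|y - x|.
  by near: y; exact: fA.
have yx : `|y - x| <= e / (1 + `|A|).
  apply: ltW; near: y; apply: near_dist.
  by rewrite divr_gt0// ltr_pwDl.
rewrite distrC -[f y - f x](subrK (A (y - x))).
rewrite (le_trans (ler_normD _ _))// (le_trans (lerD H (bop_norm _ _)))//.
rewrite -mulrDl mulrC -ler_pdivlMr// ltr_pwDl//.
Unshelve. all: by end_near. Qed.

Lemma fder_near_eq f g x A : (\forall y \near x, f y = g y) ->
  fder f x A -> fder g x A.
Proof.
move=> fg fA e e0; have fgx := nbhs_singleton fg.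
near=> y; rewrite -fgx -(near fg y)//; near: y; exact: fA.
Unshelve. all: by end_near. Qed.

Lemma fderD f g x A B : fder f x A -> fder g x B ->
  fder (fun y => f y + g y) x (A + B).
Proof.
move=> fA gB; apply: fder_bigO; exists 2 => e e0.
near=> y.
have fy : `|f y - f x - A (y - x)| <= e * `|y - x| by near: y; exact: fA.
have gy : `|g y - g x - B (y - x)| <= e * `|y - x| by near: y; exact: gB.
rewrite bopE (_ : _ - _ = (f y - f x - A (y - x)) + (g y - g x - B (y - x))); last first.
  by rewrite !opprD [X in X + _ = _]addrACA [LHS]addrACA.
rewrite (le_trans (ler_normD _ _))//; lra.
Unshelve. all: by end_near. Qed.

Lemma fder_cst (c : W) x : fder (fun=> c) x 0.
Proof.
move=> e e0; near=> y; rewrite subrr bopE subrr normr0.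
by rewrite mulr_ge0// ltW.
Unshelve. all: by end_near. Qed.

Lemma fder_bop A x : fder A x A.
Proof.
move=> e e0; near=> y; rewrite bopB subrr normr0.
by rewrite mulr_ge0// ltW.
Unshelve. all: by end_near. Qed.

(* [0] where [f] is not differentiable. *)
Definition der f x : bop V W := xget 0 [set A | fder f x A].

Lemma derP f x A : fder f x A -> fder f x (der f x).
Proof. by move=> fA; exact: (xgetI 0 fA). Qed.

Lemma der_eq f x A : fder f x A -> der f x = A.
Proof. by move=> fA; apply: (fder_unique (derP fA) fA). Qed.

(** Holds without differentiability: both functions have the same set of derivatives at [x], so
    [xget] makes the same choice. *)
Lemma der_near_eq f g x : (\forall y \near x, f y = g y) -> der f x = der g x.
Proof.
move=> fg; have gf : \forall y \near x, g y = f y.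
  by apply: filterS fg => y ->.
rewrite /der; congr (xget _ _); apply/seteqP.
by split=> A /=; apply: fder_near_eq.
Qed.

End FrechetDerivative.

Section Composition.
Context {R : realType} {U V W : normedModType R}.

Let comp_lin (B : bop V W) (A : bop U V) : linear (fun x => B (A x)).
Proof. by move=> a x y; rewrite !bopD !bopZ. Qed.
Let comp_bnd (B : bop V W) (A : bop U V) :
  exists M : R, forall x, `|B (A x)| <= M * `|x|.
Proof.
exists (`|B| * `|A|) => x; rewrite (le_trans (bop_norm _ _))//.
by rewrite -mulrA ler_wpM2l ?bop_norm.
Qed.
Definition bop_comp B A := Bop (comp_lin B A) (comp_bnd B A).

Lemma fder_comp (f : U -> V) (g : V -> W) x A B :
  fder f x A -> fder g (f x) B -> fder (g \o f) x (bop_comp B A).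
Proof.
move=> fA gB; apply: fder_bigO; exists (1 + `|A| + `|B|) => e e0.
have fx := fder_cvg fA.
have g1 := fx _ (gB _ e0).
near=> y; rewrite /=.
have H1 : `|f y - f x - A (y - x)| <= 1 * `|y - x| by near: y; exact: fA.
have H2 : `|f y - f x - A (y - x)| <= e * `|y - x| by near: y; exact: fA.
have H3 : `|g (f y) - g (f x) - B (f y - f x)| <= e * `|f y - f x|.
  by near: y; exact: g1.
rewrite (_ : _ - _ = (g (f y) - g (f x) - B (f y - f x)) +
    B (f y - f x - A (y - x))); last first.
  by rewrite (bopB B (f y - f x)) addrA subrK.
have H4 : `|f y - f x| <= (1 + `|A|) * `|y - x|.
  rewrite -[f y - f x](subrK (A (y - x))) (le_trans (ler_normD _ _))//.
  by rewrite mulrDl lerD// bop_norm.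
have H5 : `|B (f y - f x - A (y - x))| <= `|B| * (e * `|y - x|).
  by rewrite (le_trans (bop_norm _ _))// ler_wpM2l.
have H6 : `|g (f y) - g (f x) - B (f y - f x)| <= e * ((1 + `|A|) * `|y - x|).
  by rewrite (le_trans H3)// ler_wpM2l// ltW.
rewrite (le_trans (ler_normD _ _))// (le_trans (lerD H6 H5))//.
by rewrite le_eqVlt; apply/orP; left; apply/eqP; ring.
Unshelve. all: by end_near. Qed.

End Composition.

(** * Bounded bilinear maps and the product rule *)

Record bilin (R : realType) (U V W : normedModType R) := Bilin {
  bilin_fun :> U -> V -> W;
  bilin_linl : forall b, linear (bilin_fun^~ b);
  bilin_linr : forall a, linear (bilin_fun a);
  bilin_bnd : exists M : R, forall a b, `|bilin_fun a b| <= M * `|a| * `|b| }.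

Section Bilinear.
Context {R : realType} {U V W : normedModType R}.
Implicit Types B : bilin U V W.

Lemma bilin_bound_gt0 B :
  exists2 M : R, 0 < M & forall a b, `|B a b| <= M * `|a| * `|b|.
Proof.
have [M BM] := bilin_bnd B; exists (`|M| + 1) => [|a b]; first by rewrite ltr_pwDr.
rewrite (le_trans (BM a b))// -!mulrA ler_wpM2r ?mulr_ge0//.
by rewrite (le_trans (ler_norm M))// lerDl.
Qed.

Let linl_bnd B b : exists M : R, forall a, `|B a b| <= M * `|a|.
Proof.
have [M _ BM] := bilin_bound_gt0 B; exists (M * `|b|) => a.
by rewrite mulrAC.
Qed.
Definition bilin_left B b : bop U W := Bop (bilin_linl B b) (linl_bnd B b).

Let linr_bnd B a : exists M : R, forall b, `|B a b| <= M * `|b|.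
Proof. by have [M _ BM] := bilin_bound_gt0 B; exists (M * `|a|). Qed.
Definition bilin_right B a : bop V W := Bop (bilin_linr B a) (linr_bnd B a).

Lemma bilinBl B a a' b : B (a - a') b = B a b - B a' b.
Proof. exact: (bopB (bilin_left B b)). Qed.
Lemma bilinBr B a b b' : B a (b - b') = B a b - B a b'.
Proof. exact: (bopB (bilin_right B a)). Qed.

End Bilinear.

Section BilinearDerivative.
Context {R : realType} {X U V W : normedModType R} (B : bilin U V W).

Let dl_lin A b : linear (fun h : X => B ((A : bop X U) h) b).
Proof. by move=> a x y; rewrite bopD bopZ bilin_linl. Qed.
Let dl_bnd A b : exists M : R, forall h : X, `|B ((A : bop X U) h) b| <= M * `|h|.
Proof.
have [M M0 BM] := bilin_bound_gt0 B; exists (M * `|A| * `|b|) => h.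
rewrite (le_trans (BM _ _))// [leRHS]mulrAC ler_wpM2r// -mulrA ler_wpM2l ?(ltW M0)//.
exact: bop_norm.
Qed.
Definition bilin_dl_fun A b := Bop (dl_lin A b) (dl_bnd A b).

Let dl_linl b : linear (bilin_dl_fun^~ b).
Proof. by move=> a x y; apply: bop_eq => h /=; rewrite -bilin_linl. Qed.
Let dl_linr A : linear (bilin_dl_fun A).
Proof. by move=> a x y; apply: bop_eq => h /=; rewrite -bilin_linr. Qed.
Let dl_bilin_bnd : exists M : R, forall A b, `|bilin_dl_fun A b| <= M * `|A| * `|b|.
Proof.
have [M M0 BM] := bilin_bound_gt0 B; exists M => A b.
apply: bop_norm_le => [|h /=]; first by rewrite !mulr_ge0// ltW.
rewrite (le_trans (BM _ _))// [leRHS]mulrAC ler_wpM2r// -mulrA ler_wpM2l ?(ltW M0)//.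
exact: bop_norm.
Qed.
(** With [bilin_dr], one of the two halves of the product rule. Both are again bounded bilinear
    maps, which is what lets [Ck_bilin] proceed by induction. *)
Definition bilin_dl : bilin (bop X U) V (bop X W) :=
  Bilin dl_linl dl_linr dl_bilin_bnd.

Let dr_lin a C : linear (fun h : X => B a ((C : bop X V) h)).
Proof. by move=> c x y; rewrite bopD bopZ bilin_linr. Qed.
Let dr_bnd a C : exists M : R, forall h : X, `|B a ((C : bop X V) h)| <= M * `|h|.
Proof.
have [M M0 BM] := bilin_bound_gt0 B; exists (M * `|a| * `|C|) => h.
rewrite (le_trans (BM _ _))// -[leRHS]mulrA ler_wpM2l ?bop_norm//.
by rewrite mulr_ge0// ltW.
Qed.
Definition bilin_dr_fun a C := Bop (dr_lin a C) (dr_bnd a C).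

Let dr_linl C : linear (bilin_dr_fun^~ C).
Proof. by move=> a x y; apply: bop_eq => h /=; rewrite -bilin_linl. Qed.
Let dr_linr a : linear (bilin_dr_fun a).
Proof. by move=> c x y; apply: bop_eq => h /=; rewrite -bilin_linr. Qed.
Let dr_bilin_bnd : exists M : R, forall a C, `|bilin_dr_fun a C| <= M * `|a| * `|C|.
Proof.
have [M M0 BM] := bilin_bound_gt0 B; exists M => a C.
apply: bop_norm_le => [|h /=]; first by rewrite !mulr_ge0// ltW.
rewrite (le_trans (BM _ _))// -[leRHS]mulrA ler_wpM2l ?bop_norm//.
by rewrite mulr_ge0// ltW.
Qed.
Definition bilin_dr : bilin U (bop X V) (bop X W) :=
  Bilin dr_linl dr_linr dr_bilin_bnd.

Lemma fder_bilin (f : X -> U) (g : X -> V) x A C :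
  fder f x A -> fder g x C ->
  fder (fun y => B (f y) (g y)) x (bilin_dl A (g x) + bilin_dr (f x) C).
Proof.
move=> fA gC; have [M M0 BM] := bilin_bound_gt0 B.
apply: fder_bigO; exists (M * (1 + `|g x| + `|A| + `|f x|)) => e e0.
have gx := fder_cvg gC.
near=> y.
have H1 : `|f y - f x - A (y - x)| <= e * `|y - x| by near: y; exact: fA.
have H2 : `|g y - g x - C (y - x)| <= e * `|y - x| by near: y; exact: gC.
have H3 : `|g y - g x| <= e.
  by rewrite distrC; near: y; move/cvgrPdist_le : gx; apply.
have H4 : `|g y - g x| <= 1.
  by rewrite distrC; near: y; move/cvgrPdist_le : gx; apply.
have H5 : `|g y| <= 1 + `|g x|.
  by rewrite -[g y](subrK (g x)) (le_trans (ler_normD _ _))// lerD.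
(* The error splits into the remainder of [f], a cross term, and the remainder of [g]. The cross
   term is small because [g] is continuous at [x]. *)
rewrite bopE /= (_ : _ - _ = B (f y - f x - A (y - x)) (g y) +
  B (A (y - x)) (g y - g x) + B (f x) (g y - g x - C (y - x))); last first.
  rewrite !bilinBl !bilinBr.
  move: (B (f y) (g y)) (B (A (y - x)) (g x)) (B (A (y - x)) (g y)) (B (f x) (g y)).
  move: (B (f x) (g x)) (B (f x) (C (y - x))) => q s p r w u.
  by rewrite opprD !addrA subrK (addrAC p (- u)) subrK (addrAC p (- r)).
have K1 : `|B (f y - f x - A (y - x)) (g y)| <= M * (e * `|y - x|) * (1 + `|g x|).
  apply: (le_trans (BM _ _)); apply: ler_pM => //; first by rewrite mulr_ge0// ltW.
  by rewrite ler_wpM2l// ltW.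
have K2 : `|B (A (y - x)) (g y - g x)| <= M * (`|A| * `|y - x|) * e.
  apply: (le_trans (BM _ _)); apply: ler_pM => //; first by rewrite mulr_ge0// ltW.
  by rewrite ler_wpM2l ?bop_norm// ltW.
have K3 : `|B (f x) (g y - g x - C (y - x))| <= M * `|f x| * (e * `|y - x|).
  by rewrite (le_trans (BM _ _))// ler_wpM2l ?mulr_ge0// ltW.
rewrite (le_trans (ler_normD _ _))//.
rewrite (le_trans (lerD (le_trans (ler_normD _ _) (lerD K1 K2)) K3))//.
by rewrite le_eqVlt; apply/orP; left; apply/eqP; ring.
Unshelve. all: by end_near. Qed.

End BilinearDerivative.

(** * Smoothness by iterated derivatives *)

Section Ck.
Context {R : realType} {X : normedModType R}.

(** Pointwise smoothness: the derivatives up to order [n] exist near [x], and the last one is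
    continuous at [x]. The target varies in the recursion, since [der f] has values in [bop X W]. *)
Fixpoint Ck (n : nat) {W : normedModType R} (f : X -> W) (x : X) : Prop :=
  if n is n'.+1 then (\forall y \near x, fder f y (der f y)) /\ Ck n' (der f) x
  else f y @[y --> x] --> f x.

Lemma Ck_near_eq n (W : normedModType R) (f g : X -> W) x :
  (\forall y \near x, f y = g y) -> Ck n f x -> Ck n g x.
Proof.
elim: n W f g => [|n IH] W f g fg /=.
  by rewrite -(nbhs_singleton fg) => fx; apply: cvg_trans fx; apply: near_eq_cvg;
    apply: filterS fg => y ->.
have fg' : \forall y \near x, \forall z \near y, f z = g z := nbhs_interior fg.
move=> [fd Cf]; split; last first.
  by apply: IH Cf; apply: filterS fg' => y; apply: der_near_eq.
near=> y; have fgy : \forall z \near y, f z = g z by near: y.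
by rewrite -(der_near_eq fgy); apply: fder_near_eq fgy _; near: y.
Unshelve. all: by end_near. Qed.

Lemma Ck_cvg n (W : normedModType R) (f : X -> W) x :
  Ck n f x -> f y @[y --> x] --> f x.
Proof. by case: n => [//|n] [/nbhs_singleton /fder_cvg]. Qed.

Lemma CkW n (W : normedModType R) (f : X -> W) x : Ck n.+1 f x -> Ck n f x.
Proof.
elim: n W f => [|n IH] W f; first exact: Ck_cvg.
by move=> [fd /IH].
Qed.

(** By uniqueness of derivatives, any explicit formula valid near [x] may stand for [der f]. *)
Lemma Ck_intro n (W : normedModType R) (f : X -> W) (A : X -> bop X W) x :
  (\forall y \near x, fder f y (A y)) -> Ck n A x -> Ck n.+1 f x.
Proof.
move=> fA CA; split; first by apply: filterS fA => y /derP.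
by apply: Ck_near_eq CA; apply: filterS fA => y /der_eq ->.
Qed.

Lemma Ck_cst n (W : normedModType R) (c : W) x : Ck n (fun=> c) x.
Proof.
elim: n W c => [|n IH] W c; first exact: cvg_cst.
by apply: (Ck_intro _ (IH _ 0)); near=> y; exact: fder_cst.
Unshelve. all: by end_near. Qed.

Lemma Ck_bop n (W : normedModType R) (A : bop X W) x : Ck n A x.
Proof.
case: n => [|n]; first exact: fder_cvg (fder_bop A x).
by apply: (Ck_intro _ (Ck_cst _ A x)); near=> y; exact: fder_bop.
Unshelve. all: by end_near. Qed.

Lemma CkD n (W : normedModType R) (f g : X -> W) x :
  Ck n f x -> Ck n g x -> Ck n (fun y => f y + g y) x.
Proof.
elim: n W f g => [|n IH] W f g; first exact: cvgD.
move=> [fd Cf] [gd Cg]; apply: Ck_intro (IH _ _ _ Cf Cg).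
by near=> y; apply: fderD; near: y.
Unshelve. all: by end_near. Qed.

(** The induction runs over all bilinear maps at once: the derivative of [B (f y) (g y)] is a sum of
    two terms of the same shape, for [bilin_dl B] and [bilin_dr B]. *)
Lemma Ck_bilin n (U V W : normedModType R) (B : bilin U V W)
    (f : X -> U) (g : X -> V) x :
  Ck n f x -> Ck n g x -> Ck n (fun y => B (f y) (g y)) x.
Proof.
elim: n U V W B f g => [|n IH] U V W B f g.
  move=> fx gx; apply/cvgrPdist_le => e e0.
  have [M M0 BM] := bilin_bound_gt0 B.
  pose K := M * (2 + `|f x| + `|g x|).
  have K0 : 0 < K by rewrite mulr_gt0// -addrA ltr_pwDl// addr_ge0.
  near=> y; have H1 : `|f x - f y| <= e / K.
    by near: y; move/cvgrPdist_le : fx; apply; rewrite divr_gt0.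
  have H2 : `|g x - g y| <= e / K.
    by near: y; move/cvgrPdist_le : gx; apply; rewrite divr_gt0.
  have H3 : `|g x - g y| <= 1 by near: y; move/cvgrPdist_le : gx; apply.
  have H4 : `|g y| <= 1 + `|g x|.
    rewrite -[g y](subrK (g x)) (le_trans (ler_normD _ _))// lerD//.
    by rewrite distrC.
  rewrite (_ : _ - _ = B (f x - f y) (g y) + B (f x) (g x - g y)); last first.
    by rewrite bilinBl bilinBr [RHS]addrC addrA subrK.
  have K1 : `|B (f x - f y) (g y)| <= M * (e / K) * (1 + `|g x|).
    by apply: (le_trans (BM _ _)); apply: ler_pM => //;
      [rewrite mulr_ge0// ltW | rewrite ler_wpM2l// ltW].
  have K2 : `|B (f x) (g x - g y)| <= M * `|f x| * (e / K).
    by apply: (le_trans (BM _ _)); rewrite ler_wpM2l// mulr_ge0// ltW.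
  rewrite (le_trans (ler_normD _ _))// (le_trans (lerD K1 K2))//.
  have -> : M * (e / K) * (1 + `|g x|) + M * `|f x| * (e / K) =
      e * ((M * (1 + `|f x| + `|g x|)) / K) by ring.
  rewrite ler_piMr ?(ltW e0)// ler_pdivrMr// mul1r ler_wpM2l ?(ltW M0)//.
  by rewrite !lerD2r ler1n.
move=> fC gC; have [[fd Cf] [gd Cg]] := (fC, gC).
have Cf' := CkW fC; have Cg' := CkW gC.
apply: Ck_intro (CkD (IH _ _ _ (bilin_dl B) _ _ Cf Cg')
                     (IH _ _ _ (bilin_dr B) _ _ Cf' Cg)).
by near=> y; apply: fder_bilin; near: y.
Unshelve. all: by end_near. Qed.

End Ck.

Section Composition.
Context {R : realType} {U V W : normedModType R}.

Let comp_linl (A : bop U V) : linear (fun B : bop V W => bop_comp B A).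
Proof. by move=> a B C; apply: bop_eq. Qed.
Let comp_linr (B : bop V W) : linear (fun A : bop U V => bop_comp B A).
Proof. by move=> a A C; apply: bop_eq => x /=; rewrite -bop_lin. Qed.
Let comp_bnd : exists M : R, forall (B : bop V W) (A : bop U V),
  `|bop_comp B A| <= M * `|B| * `|A|.
Proof.
exists 1 => B A; rewrite mul1r; apply: bop_norm_le => [|x]; first exact: mulr_ge0.
by rewrite (le_trans (bop_norm B _))// -mulrA ler_wpM2l ?bop_norm.
Qed.
Definition bilin_comp := Bilin comp_linl comp_linr comp_bnd.

End Composition.

Section CompositionCk.
Context {R : realType} {U V : normedModType R}.

(** The chain rule writes the derivative as [bilin_comp] of [der g] after [f] and [der f]. The
    induction hypothesis handles the first factor and [Ck_bilin] the product. *)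
Lemma Ck_comp n (W : normedModType R) (f : U -> V) (g : V -> W) x :
  Ck n f x -> Ck n g (f x) -> Ck n (fun y => g (f y)) x.
Proof.
elim: n W g => [|n IH] W g; first by move=> fx gx; exact: (cvg_comp _ _ fx gx).
move=> fC gC; have fx := Ck_cvg fC; have [[fd Cf] [gd Cg]] := (fC, gC).
have Cgf := IH _ _ (CkW fC) Cg.
apply: Ck_intro (Ck_bilin (bilin_comp (W := W)) Cgf Cf).
have gfd := fx _ gd.
by near=> y; apply: fder_comp; near: y.
Unshelve. all: by end_near. Qed.

End CompositionCk.

Section Scaling.
Context {R : realType}.

Section ScalingBilinear.
Context {W : normedModType R}.
Let scale_linl (w : W) : linear (fun a : R^o => a *: w).
Proof. by move=> a b c; rewrite scalerDl scalerA. Qed.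
Let scale_linr (a : R^o) : linear (fun w : W => a *: w).
Proof. by move=> b v w; rewrite scalerDr !scalerA mulrC. Qed.
Let scale_bnd : exists M : R, forall (a : R^o) (w : W), `|a *: w| <= M * `|a| * `|w|.
Proof. by exists 1 => a w; rewrite mul1r normrZ. Qed.
Definition bilin_scale : bilin R^o W W := Bilin scale_linl scale_linr scale_bnd.
End ScalingBilinear.

Let mulop_linear : linear (bilin_left (bilin_scale (W := R^o)) : R^o -> bop R^o R^o).
Proof. by move=> a x y; apply: bop_eq => z /=; rewrite scalerDr !scalerA (mulrC z). Qed.

Let mulop_bound : exists M : R, forall d : R^o,
  `|bilin_left (bilin_scale (W := R^o)) d| <= M * `|d|.
Proof.
exists 1 => d; rewrite mul1r; apply: bop_norm_le => // x /=.
by rewrite normrZ mulrC.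
Qed.
(** Turns a real derivative into a Fréchet derivative. Being a bounded operator itself, it preserves
    smoothness. *)
Definition mulop : bop R^o (bop R^o R^o) := Bop mulop_linear mulop_bound.

Lemma fder_is_derive (f : R^o -> R^o) (x d : R) :
  is_derive (x : R^o) (1 : R^o) f d -> fder f x (mulop d).
Proof.
move=> [fx fxd] e e0; move: fx; rewrite /derivable => /cvg_ex [l fl].
have ld : l = d by rewrite -fxd; apply/esym/cvg_lim.
move/cvgrPdist_le: fl => /(_ _ e0) /= fl.
have {}fl : \forall h \near (0 : R^o), h != 0 ->
  `|l - h^-1 *: (f (h *: 1 + x) - f x)| <= e by exact: fl.
have [r r0 Hr] := near_normP fl; apply: (near_norm r0) => y yx.
change (`|f y - f x - (y - x) * d| <= e * `|y - x|).
have [->|yx0] := eqVneq y x; first by rewrite !subrr mul0r subrr normr0 mulr0.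
have := Hr (y - x); rewrite subr0 subr_eq0 => /(_ yx yx0).
rewrite [_ *: 1]mulr1 subrK distrC -ld => H.
have yxn : y - x != 0 by rewrite subr_eq0.
rewrite (_ : _ - _ = (y - x) * ((y - x)^-1 * (f y - f x) - l)).
  by rewrite normrM mulrC ler_wpM2r.
by rewrite mulrBr mulrA mulfV// mul1r.
Qed.

Lemma Ck_derive n (f f' : R^o -> R^o) (x : R^o) :
  (\forall y \near x, is_derive y (1 : R^o) f (f' y)) -> Ck n f' x -> Ck n.+1 f x.
Proof.
move=> ff' f'x; apply: (Ck_intro (A := fun y => mulop (f' y))).
  by apply: filterS ff' => y; exact: fder_is_derive.
exact: Ck_comp f'x (Ck_bop _ _ _).
Qed.

Context {X : normedModType R}.

Lemma CkZ n (W : normedModType R) (a : X -> R^o) (f : X -> W) x :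
  Ck n a x -> Ck n f x -> Ck n (fun y => a y *: f y) x.
Proof. by move=> ax fx; exact: (Ck_bilin (bilin_scale (W := W)) ax fx). Qed.

Lemma CkM n (a f : X -> R^o) x :
  Ck n a x -> Ck n f x -> Ck n (fun y => a y * f y : R^o) x.
Proof. exact: CkZ. Qed.

Lemma CkN n (W : normedModType R) (f : X -> W) x :
  Ck n f x -> Ck n (fun y => - f y) x.
Proof.
move=> fx; have := CkZ (Ck_cst n (-1 : R^o) x) fx.
by apply: Ck_near_eq; near=> y; rewrite scaleN1r.
Unshelve. all: by end_near. Qed.

Lemma CkB n (W : normedModType R) (f g : X -> W) x :
  Ck n f x -> Ck n g x -> Ck n (fun y => f y - g y) x.
Proof. by move=> fx /CkN; exact: CkD. Qed.

Lemma Ck_sum n (W : normedModType R) (I : Type) (r : seq I) (f : I -> X -> W) x :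
  (forall i, Ck n (f i) x) -> Ck n (fun y => \sum_(i <- r) f i y) x.
Proof.
move=> fx; elim: r => [|i r IH].
  by apply: Ck_near_eq (Ck_cst n 0 x); near=> y; rewrite big_nil.
by apply: Ck_near_eq (CkD (fx i) IH); near=> y; rewrite big_cons.
Unshelve. all: by end_near. Qed.

Lemma Ck_id n x : Ck n (fun y : X => y) x.
Proof.
have id_lin : linear (fun y : X => y) by [].
have id_bnd : exists M : R, forall y : X, `|y| <= M * `|y|.
  by exists 1 => y; rewrite mul1r.
exact: (Ck_bop n (Bop id_lin id_bnd)).
Qed.

End Scaling.

Section Inverse.
Context {R : realType}.

Lemma is_derive_inv (x : R) : x != 0 ->
  is_derive x 1 (fun y : R => y^-1) (- x^-1 ^+ 2).
Proof.
move=> x0; have dx := @derivable_id R R^o x 1.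
apply: DeriveDef; first exact: (derivableV (f := id)).
by rewrite (deriveV (f := id))// derive_id /GRing.scale/= mulr1 -exprVn.
Qed.

(** The derivative is minus the product of two copies of the function, so the induction hypothesis
    applies to it. *)
Lemma Ck_Rinv n (x : R^o) : x != 0 -> Ck n (fun y : R^o => y^-1 : R^o) x.
Proof.
move=> x0; have near0 : \forall y \near x, y != 0.
  apply: (near_norm (d := `|x|)); first by rewrite normr_gt0.
  by move=> y; apply: contraTneq => ->; rewrite sub0r normrN ltxx.
elim: n => [|n IH]; first exact: (@inv_continuous _ _ x0).
apply: (Ck_derive (f' := fun y => - (y^-1 * y^-1))).
  apply: filterS near0 => y y0.
  by rewrite -expr2; exact: is_derive_inv.
by apply: CkN; exact: CkM.
Qed.

Lemma Ck_inv (X : normedModType R) n (f : X -> R^o) x :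
  f x != 0 -> Ck n f x -> Ck n (fun y => (f y)^-1 : R^o) x.
Proof. by move=> fx0 fx; exact: Ck_comp fx (Ck_Rinv n fx0). Qed.

End Inverse.

(** * Smoothness of the solution of a scalar implicit equation *)

Section Implicit.
Context {R : realType} {X : normedModType R}.
Variables (N q : X -> R^o) (v : X).
Let P w := w - q w *: v.

(** Differentiating [q w = N (w - q w *: v)] gives [(1 + B v) q' = B]. As [B v >= 0], the factor is
    at least [1], so it can be inverted with no contraction argument. *)
Lemma fder_implicit w (B : bop X R^o) : q y @[y --> w] --> q w ->
  (\forall y \near w, q y = N (P y)) -> fder N (P w) B -> 0 <= B v ->
  fder q w ((1 + B v)^-1 *: B).
Proof.
move=> qw qN NB Bv; have b1 : 1 <= 1 + B v by rewrite lerDl.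
have b0 : 0 < 1 + B v by rewrite (lt_le_trans _ b1).
apply: fder_bigO; exists (1 + 2 * (`|B| + 1) * `|v|) => e e0.
have Pw : P y @[y --> w] --> P w.
  by apply: cvgB; [exact: cvg_id | apply: cvgZr_tmp].
(* Small enough that [e1 * |d| * |v|] is absorbed into half of [|d|]. This yields the Lipschitz
   bound [dk] for [q] at [w]. *)
pose e1 := (2 * (1 + `|v|))^-1 : R.
have e10 : 0 < e1 by rewrite invr_gt0 mulr_gt0// ltr_pwDl.
have NB1 := Pw _ (NB _ e10); have NB2 := Pw _ (NB _ e0).
have qNw := nbhs_singleton qN.
near=> y.
have Ey : q y = N (P y) by near: y.
set k := y - w; set d := q y - q w.
have PE : P y - P w = k - d *: v.
  rewrite /P /k /d scalerBl !opprB (addrC (q w *: v) (- w)) addrACA.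
  by rewrite (addrC (q w *: v)).
have H1 : `|N (P y) - N (P w) - B (P y - P w)| <= e1 * `|P y - P w| by near: y.
have H2 : `|N (P y) - N (P w) - B (P y - P w)| <= e * `|P y - P w| by near: y.
have Pn : `|P y - P w| <= `|k| + `|d| * `|v|.
  by rewrite PE (le_trans (ler_normB _ _))// normrZ.
have rE : N (P y) - N (P w) - B (P y - P w) = (1 + B v) * d - B k.
  rewrite -Ey -qNw PE bopB bopZ -/d /GRing.scale /=; ring.
rewrite rE in H1 H2.
have e1v : e1 * `|v| <= 2^-1.
  by rewrite /e1 invfM -mulrA ler_piMr// mulrC ler_pdivrMr ?mul1r ?lerDr//.
have e11 : e1 <= 1.
  rewrite invf_le1 ?mulr_gt0 ?ltr_pwDl//.
  by have := normr_ge0 v; lra.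
have dk : `|d| <= 2 * (`|B| + 1) * `|k|.
  have d1 : `|d| <= `|(1 + B v) * d|.
    by rewrite normrM (gtr0_norm b0) ler_peMl.
  have d2 : `|(1 + B v) * d| <= `|B k| + e1 * `|P y - P w|.
    by rewrite -[(1 + B v) * d](subrK (B k)) addrC (le_trans (ler_normD _ _))// lerD2l.
  have d3 := bop_norm B k.
  have d4 : e1 * `|P y - P w| <= `|k| + 2^-1 * `|d|.
    rewrite (le_trans (ler_wpM2l (ltW e10) Pn))// mulrDr lerD//.
      by rewrite ler_piMl.
    by rewrite mulrCA mulrC ler_wpM2r.
  lra.
have -> : d - ((1 + B v)^-1 *: B) k = (1 + B v)^-1 * ((1 + B v) * d - B k).
  by rewrite bopE /GRing.scale /= mulrBr mulKf ?gt_eqF.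
rewrite normrM ger0_norm ?invr_ge0 ?(ltW b0)//.
have i1 : (1 + B v)^-1 <= 1 by rewrite invf_le1.
rewrite (le_trans (ler_piMl _ i1))//.
rewrite (le_trans H2)// (le_trans (ler_wpM2l (ltW e0) Pn))//.
have : `|d| * `|v| <= 2 * (`|B| + 1) * `|k| * `|v| by rewrite ler_wpM2r.
move=> H; rewrite (le_trans (ler_wpM2l (ltW e0) (lerD (lexx `|k|) H)))//.
by rewrite le_eqVlt; apply/orP; left; apply/eqP; ring.
Unshelve. all: by end_near. Qed.

(** Bootstrapping: if [q] is smooth to order [n], so are [P] and the formula of [fder_implicit] for
    the derivative of [q]. Hence [q] is smooth to order [n + 1]. *)
Lemma Ck_implicit n w : (\forall y \near w, q z @[z --> y] --> q y) ->
  (\forall y \near w, q y = N (P y)) ->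
  (\forall p \near P w, 0 <= der N p v) ->
  Ck n N (P w) -> Ck n q w.
Proof.
move=> qc qN N0; elim: n => [|n IH NC]; first by move=> _; exact: nbhs_singleton qc.
have qC := IH (CkW NC); have [Nd Nd'] := NC.
have PC : Ck n P w by apply: CkB (Ck_id _ _) (CkZ qC (Ck_cst _ _ _)).
have NPC : Ck n (fun y => der N (P y)) w by exact: Ck_comp PC Nd'.
have Pw := Ck_cvg PC.
have ev_lin : linear (fun A : bop X R^o => A v) by [].
have ev_bnd : exists M : R, forall A : bop X R^o, `|A v| <= M * `|A|.
  by exists `|v| => A; rewrite mulrC bop_norm.
pose ev := Bop ev_lin ev_bnd.
apply: (Ck_intro (A := fun y => (1 + der N (P y) v)^-1 *: der N (P y))).
  have Nd1 := Pw _ Nd; have N01 := Pw _ N0.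
  have qN' : \forall y \near w, \forall z \near y, q z = N (P z) := nbhs_interior qN.
  by near=> y; apply: fder_implicit; near: y.
apply: (CkZ _ NPC); apply: Ck_inv.
  by rewrite gt_eqF// ltr_pwDl// (nbhs_singleton N0).
by apply: CkD (Ck_cst _ _ _) _; exact: (Ck_comp NPC (Ck_bop n ev _)).
Unshelve. all: by end_near. Qed.

End Implicit.

(** * The flat function *)

Section Flat.
Context {R : realType}.
Implicit Types (m n : nat) (x y : R).

(** The case [m = 0] is the usual flat function. The powers of [x^-1] give a family whose span is
    closed under differentiation. *)
Definition flat m x : R := if 0 < x then x^-1 ^+ m * expR (- x^-1) else 0.

Lemma flat_gt0E m x : 0 < x -> flat m x = x^-1 ^+ m * expR (- x^-1).
Proof. by rewrite /flat => ->. Qed.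

Lemma flat_le0 m x : x <= 0 -> flat m x = 0.
Proof. by rewrite /flat ltNge => ->. Qed.

Lemma flat_ge0 m x : 0 <= flat m x.
Proof.
rewrite /flat; case: ifP => // x0.
by rewrite mulr_ge0 ?expR_ge0// exprn_ge0// invr_ge0 ltW.
Qed.

(** The exponential of [x^-1] dominates its Taylor term of degree [m + 2]. A quadratic bound is what
    makes the derivative at [0] vanish. *)
Lemma flat_le_sqr m x : flat m x <= (m.+2)`!%:R * x ^+ 2.
Proof.
have [x0|x0] := ltP 0 x; last first.
  by rewrite flat_le0// mulr_ge0 ?ler0n ?sqr_ge0.
rewrite flat_gt0E// expRN ler_pdivrMr ?expR_gt0//.
have y0 : 0 <= x^-1 by rewrite invr_ge0 ltW.
have := expR_ge1Dxn m.+1 y0 => He.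
have F0 : 0 < (m.+2)`!%:R :> R by rewrite ltr0n fact_gt0.
rewrite (@le_trans _ _ ((m.+2)`!%:R * x ^+ 2 * (x^-1 ^+ m.+2 / (m.+2)`!%:R)))//.
  rewrite 2!(exprS x^-1) le_eqVlt; apply/orP; left; apply/eqP.
  move: (x^-1 ^+ m) (_`!%:R) F0 => X F F0; field.
  by rewrite !gt_eqF.
rewrite ler_wpM2l//; first by rewrite mulr_ge0 ?sqr_ge0// ltW.
by rewrite (le_trans _ He)// lerDr.
Qed.

Definition flat' m x : R := - (m%:R * flat m.+1 x) + flat m.+2 x.

Lemma is_derive_flat m x : is_derive x 1 (flat m) (flat' m x).
Proof.
have [x0|x0|<-] := ltgtP 0 x.
- have near0 : \forall y \near x, y^-1 ^+ m * expR (- y^-1) = flat m y.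
    by near=> y; rewrite flat_gt0E//; near: y; exact: lt_nbhsr.
  apply: (near_eq_is_derive near0).
  have xn0 : x != 0 by rewrite gt_eqF.
  have dV := is_derive_inv xn0.
  have dP (y : R) : is_derive y 1 (fun y : R => y ^+ m * expR (- y))
      (m%:R * y ^+ m.-1 * expR (- y) - y ^+ m * expR (- y)).
    have dN : is_derive y 1 (fun y : R => - y) (- 1) by exact: is_deriveNid.
    have dE := is_derive1_comp (is_derive_expR (- y)) dN.
    have dX : is_derive y 1 (fun y : R => y ^+ m) (m%:R * y ^+ m.-1).
      apply: DeriveDef; first exact: exprn_derivable.
      by rewrite exp_derive /GRing.scale /= mulr1.
    have dM : is_derive y 1 (fun y : R => y ^+ m * expR (- y))
      (y ^+ m *: (expR (- y) * -1) + expR (- y) *: (m%:R * y ^+ m.-1)) := is_deriveM dX dE.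
    by apply: (is_derive_eq dM); rewrite /GRing.scale /=; ring.
  apply: (is_derive_eq (is_derive1_comp (dP x^-1) dV)).
  rewrite /flat' !flat_gt0E//.
  by case: m {near0 dP} => [|m] /=; rewrite ?mul0r ?sub0r ?expr0 ?oppr0 ?add0r ?exprS; ring.
- have near0 : \forall y \near x, 0 = flat m y.
    by near=> y; rewrite flat_le0// ltW//; near: y; exact: lt_nbhsl.
  apply: (near_eq_is_derive near0); rewrite /flat' !flat_le0 ?(ltW x0)//.
  rewrite mulr0 oppr0 addr0; exact: is_derive_cst.
- have E : flat' m 0 = 0 by rewrite /flat' !flat_le0// mulr0 oppr0 addr0.
  rewrite E.
  have H : h^-1 *: ((flat m \o shift 0) (h *: 1) - flat m 0) @[h --> 0^'] --> (0 : R).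
    apply/cvgrPdist_le => e e0; near=> h.
    rewrite sub0r normrN /= addr0 [h *: 1]mulr1 (flat_le0 _ (lexx 0)) subr0.
    rewrite /GRing.scale /= normrM normfV.
    have h0 : h != 0 by near: h; exact: nbhs_dnbhs_neq.
    rewrite mulrC ler_pdivrMr ?normr_gt0// ger0_norm ?flat_ge0//.
    rewrite (le_trans (flat_le_sqr _ _))// -real_normK ?num_real// expr2 mulrA.
    rewrite ler_wpM2r// mulrC -ler_pdivlMr ?ltr0n ?fact_gt0//.
    rewrite ltW//; near: h; apply: dnbhs0_lt.
    by rewrite divr_gt0// ltr0n fact_gt0.
  apply: DeriveDef; first by apply/cvg_ex; exists 0.
  by apply: cvg_lim.
Unshelve. all: by end_near. Qed.

Lemma Ck_flat k m (x : R^o) : Ck k (flat m : R^o -> R^o) x.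
Proof.
elim: k m => [|k IH] m; first exact: fder_cvg (fder_is_derive (is_derive_flat m x)).
apply: (Ck_derive (f' := flat' m)).
  by near=> y; exact: is_derive_flat.
by apply: CkD (IH _); apply: CkN; apply: CkM (Ck_cst _ _ _) (IH _).
Unshelve. all: by end_near. Qed.

Lemma flat0_gt0 x : 0 < x -> 0 < flat 0 x.
Proof. by move=> x0; rewrite flat_gt0E// expr0 mul1r expR_gt0. Qed.

Lemma flat0_nondecreasing : {homo flat 0 : x y / x <= y}.
Proof.
move=> x y xy; have [x0|x0] := ltP 0 x; last by rewrite flat_le0// flat_ge0.
rewrite !flat_gt0E ?(lt_le_trans x0)// !expr0 !mul1r ler_expR lerN2.
by rewrite lef_pV2 ?posrE// (lt_le_trans x0).
Qed.

Lemma flat0_le1 x : flat 0 x <= 1.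
Proof.
have [x0|x0] := ltP 0 x; last by rewrite flat_le0.
by rewrite flat_gt0E// expr0 mul1r -[leRHS]expR0 ler_expR oppr_le0 invr_ge0 ltW.
Qed.

End Flat.

(** * Comparison with multilinear derivatives *)

Section FrechetForms.
Context {R : realType} {V : normedModType R}.

Lemma near0_near (x : V) (P : set V) :
  (\forall y \near x, P y) -> \forall h \near (0 : V), P (x + h).
Proof.
move=> /near_normP [d d0 dP]; apply: (near_norm d0) => h.
by rewrite subr0 => hd; apply: dP; rewrite (addrC x) addrK.
Qed.

Lemma near_near0 (x : V) (P : set V) :
  (\forall h \near (0 : V), P (x + h)) -> \forall y \near x, P y.
Proof.
move=> /near_normP [d d0 dP]; apply: (near_norm d0) => y yx.
by have := dP (y - x); rewrite subr0 (addrC x) subrK; apply.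
Qed.

(** The iterated derivative, uncurried. The entry [v 0] feeds the outermost differentiation, in
    accordance with [vcons h v] in [frechet_derivs]. *)
Fixpoint der_form (j : nat) {W : normedModType R} (f : V -> W) (x : V)
    (v : nat -> V) : W :=
  if j is j'.+1 then der_form j' (der f) x v (v j') else f x.

Lemma der_form_multilinear j (W : normedModType R) (f : V -> W) x :
  bounded_multilinear j (der_form j f x).
Proof.
elim: j W f => [|j IH] W f; first by split=> //; exists `|f x| => v; rewrite big_ord0 mulr1.
have [Edep Elin [M EM]] := IH _ (der f); split=> /=.
- move=> v w vw; rewrite (vw j)// (Edep v w)// => i ij.
  by rewrite vw// ltnW.
- move=> i; rewrite ltnS leq_eqVlt => /orP [/eqP -> | ij] v a y z.
    have Ej u : der_form j (der f) x (vupd v j u) = der_form j (der f) x v.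
      by apply: Edep => k kj; rewrite /vupd ltn_eqF.
    by rewrite !Ej /vupd eqxx bopD bopZ.
  by rewrite Elin// /vupd gtn_eqF.
- exists M => v; rewrite big_ord_recr/= mulrA (le_trans (bop_norm _ _))//.
  by rewrite ler_wpM2r.
Qed.

Lemma der_form_derivative j (W : normedModType R) (f : V -> W) x :
  Ck j.+1 f x -> forall e : R, 0 < e -> \forall h \near (0 : V), forall v,
    `|der_form j f (x + h) v - der_form j f x v - der_form j.+1 f x (vcons h v)|
      <= e * `|h| * \prod_(i < j) `|v i|.
Proof.
elim: j W f => [|j IH] W f [fd Cf] e e0.
  have := near0_near (nbhs_singleton fd _ e0); apply: filterS => h /=.
  by rewrite (addrC x) addrK => fh v; rewrite big_ord0 mulr1.
have := IH _ _ Cf _ e0; apply: filterS => h IHh v.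
rewrite big_ord_recr mulrA /=.
exact: (le_trans (bop_norm (_ - _ - _) (v j))) (ler_wpM2r _ (IHh v)).
Qed.

Lemma der_form_continuous j (W : normedModType R) (f : V -> W) x :
  Ck j f x -> forall e : R, 0 < e -> \forall y \near x, forall v,
    `|der_form j f y v - der_form j f x v| <= e * \prod_(i < j) `|v i|.
Proof.
elim: j W f => [|j IH] W f.
  move=> fx e e0; near=> y => v; rewrite big_ord0 mulr1 /= distrC.
  by near: y; move/cvgrPdist_le : fx; exact.
move=> [_ Cf] e e0; have := IH _ _ Cf _ e0; apply: filterS => h IHh v.
rewrite big_ord_recr mulrA /=.
exact: (le_trans (bop_norm (_ - _) (v j))) (ler_wpM2r _ (IHh v)).
Unshelve. all: by end_near. Qed.

Lemma Cp_on_of_Ck p (U : set V) (W : normedModType R) (f : V -> W) :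
  (forall n x, ord_le n p -> U x -> Ck n f x) -> Cp_on p U f.
Proof.
move=> fC; exists (fun j => der_form j f) => x Ux; split=> //.
- by move=> j _; exact: der_form_multilinear.
- by move=> j jp; apply: der_form_derivative; exact: fC.
- by move=> j jp; apply: der_form_continuous; exact: fC.
Qed.

Lemma Cp_on_Some n p (U : set V) (W : normedModType R) (f : V -> W) :
  ord_le n p -> Cp_on p U f -> Cp_on (Some n) U f.
Proof.
have le j : ord_le n p -> (j <= n)%N -> ord_le j p.
  by case: p => //= m nm jn; exact: leq_trans nm.
move=> np [D HD]; exists D => x /HD [D0 Dm Dd Dc]; split=> // j jn.
- exact/Dm/le.
- exact/Dd/le.
- exact/Dc/le.
Qed.

Lemma vupd_vcons (v : nat -> V) j h k :
  vupd (vcons h v) j.+1 k = vcons h (vupd v j k).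
Proof. by apply/funext => -[|i]. Qed.

Lemma prod_vupd (v : nat -> V) j k :
  \prod_(i < j.+1) `|vupd v j k i| = \prod_(i < j) `|v i| * `|k|.
Proof.
rewrite big_ord_recr/= /vupd eqxx; congr (_ * _); apply: eq_bigr => i _.
by rewrite ltn_eqF.
Qed.

Lemma vupdC (v : nat -> V) i j y k : (i < j)%N ->
  vupd (vupd v i y) j k = vupd (vupd v j k) i y.
Proof.
move=> ij; apply/funext => l; rewrite /vupd.
by have [->|//] := eqVneq l j; rewrite gtn_eqF.
Qed.

(** By induction on [n]: the forms [D] of [f], read with their last argument as an operator
    variable, are forms of order one less for the derivative of [f]. *)
Lemma Ck_of_Cp_Some n (U : set V) (W : normedModType R) (f : V -> W) x :
  open U -> Cp_on (Some n) U f -> U x -> Ck n f x.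
Proof.
move=> Uo; elim: n W f x => [|n IH] W f x [D HD] Ux.
  have [D0 _ _ Dc] := HD x Ux; apply/cvgrPdist_le => e e0.
  near=> y; have Uy : U y by near: y; exact: open_nbhs_nbhs.
  have [D0y _ _ _] := HD y Uy.
  have Dy : forall v, `|D 0%N y v - D 0%N x v| <= e * \prod_(i < 0) `|v i|.
    by near: y; exact: Dc.
  by have := Dy (fun=> 0); rewrite big_ord0 mulr1 D0 D0y distrC.
(* The default [0] is taken where the map in [k] is not a bounded operator. By [EE] this does not
   happen on [U] for [j <= n]. *)
pose E j x v : bop V W := xget 0 [set A : bop V W | forall k, A k = D j.+1 x (vupd v j k)].
have EE j y v k : U y -> (j <= n)%N -> E j y v k = D j.+1 y (vupd v j k).
  move=> Uy jn; have [_ /(_ j.+1 jn) [_ Dlin [M DM]] _ _] := HD y Uy.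
  have lin : linear (fun k => D j.+1 y (vupd v j k)).
    by move=> a b c; rewrite Dlin.
  have bnd : exists M : R, forall k, `|D j.+1 y (vupd v j k)| <= M * `|k|.
    exists (M * \prod_(i < j) `|v i|) => u; rewrite -mulrA -prod_vupd; exact: DM.
  exact: (@xgetI _ 0 [set A : bop V W | forall k, A k = D j.+1 y (vupd v j k)]
    (Bop lin bnd) (fun=> erefl)).
apply: (Ck_intro (A := fun y => E 0%N y (fun=> 0))).
  near=> y; have Uy : U y by near: y; exact: open_nbhs_nbhs.
  have [D0y _ /(_ 0%N isT) Dd _] := HD y Uy.
  move=> e e0; apply: near_near0; near=> h.
  have Uh : U (y + h) by near: h; apply: near0_near => //; exact: open_nbhs_nbhs.
  have [D0h _ _ _] := HD _ Uh.
  have Dh : forall v, `|D 0%N (y + h) v - D 0%N y v - D 1%N y (vcons h v)|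
      <= e * `|h| * \prod_(i < 0) `|v i| by near: h; exact: Dd.
  have := Dh (fun=> 0); rewrite big_ord0 mulr1 D0y D0h EE// (addrC y) addrK.
  by have -> : vupd (fun=> 0) 0 h = vcons h (fun=> 0) by apply/funext => -[].
apply: IH Ux; exists E => y Uy; have [_ Dm Dd Dc] := HD y Uy; split.
- move=> v; apply: bop_eq => k; rewrite !EE//; have [Ddep _ _] := Dm 1%N isT.
  by apply: Ddep => -[].
- move=> j jn; have [Ddep Dlin [M DM]] := Dm j.+1 jn; split.
  + move=> v w vw; apply: bop_eq => k; rewrite !EE//; apply: Ddep => i.
    rewrite ltnS /vupd leq_eqVlt; case: eqP => //= _; exact: vw.
  + move=> i ij v a b c; apply: bop_eq => k; rewrite !bopE !EE// !(vupdC _ _ _ ij).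
    by rewrite Dlin// ltnW.
  + exists `|M| => v; apply: bop_norm_le => [|k]; first by rewrite mulr_ge0// prodr_ge0.
    rewrite EE// (le_trans (DM _))// prod_vupd mulrA ler_wpM2r// ler_wpM2r//.
      exact: prodr_ge0.
    exact: ler_norm.
- move=> j jn e e0; near=> h => v.
  have Uh : U (y + h) by near: h; apply: near0_near => //; exact: open_nbhs_nbhs.
  apply: bop_norm_le => [|k]; first by rewrite !mulr_ge0 ?prodr_ge0// ltW.
  rewrite !bopE !EE// ?(ltnW jn)// vupd_vcons -[leRHS]mulrA -prod_vupd.
  by move: (vupd v j k); near: h; exact: Dd.
- move=> j jn e e0; near=> z => v.
  have Uz : U z by near: z; exact: open_nbhs_nbhs.
  apply: bop_norm_le => [|k]; first by rewrite !mulr_ge0 ?prodr_ge0// ltW.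
  rewrite !bopE !EE// -[leRHS]mulrA -prod_vupd.
  by move: (vupd v j k); near: z; exact: Dc.
Unshelve. all: by end_near. Qed.

Lemma Ck_of_Cp n p (U : set V) (W : normedModType R) (f : V -> W) x :
  open U -> Cp_on p U f -> ord_le n p -> U x -> Ck n f x.
Proof. by move=> Uo fC np Ux; exact: (Ck_of_Cp_Some Uo (Cp_on_Some np fC) Ux). Qed.

End FrechetForms.

(** * Functionals *)

Section HahnBanach.
Context {R : realType} {X : normedModType R}.

Definition sublinear (q : X -> R) :=
  (forall y z, q (y + z) <= q y + q z) /\
  (forall (a : R) y, 0 < a -> q (a *: y) <= a * q y).

Lemma sublinear0 q : sublinear q -> q 0 = 0.
Proof.
move=> [_ qZ]; have := qZ 2 0 (ltr0Sn _ _); have := qZ 2^-1 0.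
by rewrite !scaler0 invr_gt0 => /(_ (ltr0Sn _ _)) ? ?; lra.
Qed.

Lemma sublinear_ge q y : sublinear q -> - q (- y) <= q y.
Proof.
move=> qs; have [qD _] := qs; have := qD y (- y).
by rewrite subrr sublinear0//; lra.
Qed.

(* The largest sublinear functional below [q] whose value at [- x] is at most
   [- q x]. *)
Definition sublinear_red (q : X -> R) x y :=
  inf [set r | exists2 t, 0 <= t & r = q (y + t *: x) - t * q x].

Section Reduction.
Variables (q : X -> R) (x : X).
Hypothesis qs : sublinear q.

(** Subadditivity for [t *: x] as the sum of [y + t *: x] and [- y]. It keeps the infimum in
    [sublinear_red] finite. *)
Let red_lb y t : 0 <= t -> - q (- y) <= q (y + t *: x) - t * q x.
Proof.
have [qD qZ] := qs; rewrite le_eqVlt => /orP[/eqP <-|t0].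
  by rewrite scale0r mul0r addr0 subr0; exact: sublinear_ge.
have := qD (y + t *: x) (- y); rewrite addrAC subrr add0r => h.
have := qZ (t^-1) (t *: x); rewrite invr_gt0 scalerA mulVf ?gt_eqF// scale1r.
by move=> /(_ t0); rewrite ler_pdivlMl// => ?; lra.
Qed.

Let red_has_inf y :
  has_inf [set r | exists2 t, 0 <= t & r = q (y + t *: x) - t * q x].
Proof.
split; first by exists (q (y + 0 *: x) - 0 * q x); exists 0.
by exists (- q (- y)) => r [t t0 ->]; exact: red_lb.
Qed.

Lemma red_le y t : 0 <= t -> sublinear_red q x y <= q (y + t *: x) - t * q x.
Proof. by move=> t0; apply: ge_inf; [have [] := red_has_inf y | exists t]. Qed.

Let le_red y c : (forall t, 0 <= t -> c <= q (y + t *: x) - t * q x) ->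
  c <= sublinear_red q x y.
Proof.
by move=> H; apply: lb_le_inf; [have [] := red_has_inf y | move=> _ [t t0 ->]; exact: H].
Qed.

Lemma sublinear_red_sublinear : sublinear (sublinear_red q x).
Proof.
have [qD qZ] := qs; split=> [y z|a y a0].
  rewrite -lerBlDr; apply: le_red => t t0; rewrite lerBlDr -lerBlDl.
  apply: le_red => u u0; rewrite lerBlDl (le_trans (red_le _ (addr_ge0 t0 u0)))//.
  have := qD (y + t *: x) (z + u *: x).
  by rewrite addrACA -scalerDl; lra.
rewrite -ler_pdivrMl//; apply: le_red => t t0.
rewrite ler_pdivrMl// (le_trans (red_le _ (mulr_ge0 (ltW a0) t0)))//.
rewrite -scalerA -scalerDr mulrBr mulrA lerD2r.
exact: qZ.
Qed.

Lemma sublinear_red_le y : sublinear_red q x y <= q y.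
Proof.
by rewrite (le_trans (red_le y (lexx 0)))// scale0r mul0r addr0 subr0.
Qed.

Lemma sublinear_redN : sublinear_red q x (- x) <= - q x.
Proof.
by rewrite (le_trans (red_le _ ler01))// scale1r addNr mul1r sublinear0// sub0r.
Qed.

End Reduction.

(** Hahn-Banach by Zorn: take a minimal sublinear [q] below [p]. Minimality forces
    [sublinear_red q y = q] for every [y], hence [q (- y) = - q y], and an odd sublinear functional
    is linear. *)
Lemma linear_below p : sublinear p ->
  exists2 phi : X -> R^o, linear phi & forall y, phi y <= p y.
Proof.
move=> ps; pose T := {q : X -> R | sublinear q /\ forall y, q y <= p y}.
pose below (s t : T) := `[< forall y, sval t y <= sval s y >].
have lb (q : T) y : - p (- y) <= sval q y.
  case: q => q [qs qp] /=; rewrite (le_trans _ (sublinear_ge y qs))//.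
  by rewrite lerN2.
have [||s t st ts|A tA|[q [qs qp]] qmin] := @Zorn T below.
- by move=> s; apply/asboolP.
- by move=> s t u /asboolP st /asboolP tu; apply/asboolP => y; rewrite (le_trans (tu y)).
- move/asboolP in st; move/asboolP in ts.
  case: s t st ts => s Ps [t Pt] /= st ts.
  have E : s = t by apply/funext => y; apply/eqP; rewrite eq_le st ts.
  by rewrite -E in Pt *; congr exist; exact: Prop_irrelevance.
(* The empty chain is bounded by [p]. A nonempty chain is bounded by its pointwise infimum, where
   subadditivity comes from comparing two members and using the smaller one. *)
- have [[q0 Aq0]|A0] := pselect (exists q, A q); last first.
    exists (exist _ p (conj ps (fun=> lexx _))) => q Aq.
    by exfalso; apply: A0; exists q.
  pose m y := inf [set sval q y | q in A].
  have hinf y : has_inf [set sval q y | q in A].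
    split; first by exists (sval q0 y); exists q0.
    by exists (- p (- y)) => _ [q _ <-].
  have m_le q y : A q -> m y <= sval q y.
    by move=> Aq; apply: ge_inf; [have [] := hinf y | exists q].
  have le_m y c : (forall q, A q -> c <= sval q y) -> c <= m y.
    by move=> H; apply: lb_le_inf; [have [] := hinf y | move=> _ [q Aq <-]; exact: H].
  have ms : sublinear m.
    split=> [y z|a y a0].
      rewrite -lerBlDr; apply: (le_m) => q Aq; rewrite lerBlDr -lerBlDl.
      apply: (le_m) => u Au; rewrite lerBlDl.
      have [/asboolP qu|/asboolP uq] := tA q u Aq Au.
        rewrite (le_trans (m_le u _ Au))// (le_trans ((svalP u).1.1 y z))//.
        by rewrite lerD2r; exact: qu.
      rewrite (le_trans (m_le q _ Aq))// (le_trans ((svalP q).1.1 y z))//.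
      by rewrite lerD2l; exact: uq.
    rewrite -ler_pdivrMl//; apply: (le_m) => q Aq.
    by rewrite ler_pdivrMl// (le_trans (m_le q _ Aq))// (svalP q).1.2.
  have mp y : m y <= p y by rewrite (le_trans (m_le _ y Aq0))// (svalP q0).2.
  by exists (exist _ m (conj ms mp)) => q Aq; apply/asboolP => y /=; exact: m_le.
have qN y : q (- y) = - q y.
  apply/eqP; rewrite eq_le; apply/andP; split; last first.
    by have := sublinear_ge (- y) qs; rewrite opprK.
  have rs := sublinear_red_sublinear y qs.
  have rp z : sublinear_red q y z <= p z.
    exact: le_trans (sublinear_red_le y qs z) (qp z).
  have /(congr1 sval) /= E := qmin (exist _ _ (conj rs rp)) (asboolT (sublinear_red_le y qs)).
  by rewrite -{1}E; exact: sublinear_redN.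
have [qD qZ] := qs.
have qDE y z : q (y + z) = q y + q z.
  apply/eqP; rewrite eq_le qD/=.
  by have := qD (- y) (- z); rewrite -opprD !qN; lra.
have qZ0 (a : R) y : 0 < a -> q (a *: y) = a * q y.
  move=> a0; apply/eqP; rewrite eq_le qZ//=.
  by have := qZ a (- y) a0; rewrite scalerN !qN; lra.
exists q => // a y z; rewrite qDE; congr (_ + _).
have [a0|a0|<-] := ltgtP 0 a; first exact: qZ0.
- by rewrite -[a]opprK scaleNr qN qZ0 ?oppr_gt0// [RHS]mulNr.
- by rewrite scale0r sublinear0// [RHS]mul0r.
Qed.

(** A linear functional below the reduction of the norm at [x] satisfies [phi (- x) <= - |x|], so it
    attains the norm at [x]. *)
Lemma norming_functional (x : X) :
  exists phi : bop X R^o, (forall y, `|phi y| <= `|y|) /\ phi x = `|x|.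
Proof.
have ns : sublinear (fun y => `|y|).
  by split=> [y z|a y a0]; [exact: ler_normD | rewrite normrZ gtr0_norm].
have [phi lin phi_le] := linear_below (sublinear_red_sublinear x ns).
have phiN y : phi (- y) = - phi y.
  have phi0 : phi 0 = 0.
    by have := lin 1 0 0; rewrite !scale1r addr0 => ?; lra.
  by have := lin (-1) y 0; rewrite !addr0 !scaleN1r phi0 addr0.
have phi_norm y : `|phi y| <= `|y|.
  have le z : phi z <= `|z|.
    exact: le_trans (phi_le z) (sublinear_red_le x ns z).
  by rewrite ler_norml lerNl -phiN -{1}[`|y|]normrN !le.
have bnd : exists M : R, forall y, `|phi y| <= M * `|y|.
  by exists 1 => y; rewrite mul1r.
exists (Bop lin bnd); split=> //=; apply/eqP; rewrite eq_le.
have := phi_le (- x); have := sublinear_redN x ns; rewrite phiN => h1 h2.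
have := phi_norm x; have := ler_norm (phi x); lra.
Qed.

End HahnBanach.

(** * Triangular systems of vectors and functionals *)

Section TriangularSystem.
Context {R : realType} {X : normedModType R}.

(** A common kernel has finite codimension. A new functional either vanishes on the kernel of the
    previous ones, or costs one more vector [u] of that kernel, on which it does not vanish. *)
Lemma finite_codimension (s : seq (bop X R^o)) :
  exists (m : nat) (e : nat -> X), forall x, exists c : nat -> R,
    forall phi : bop X R^o, phi \in s -> phi (x - \sum_(i < m) c i *: e i) = 0.
Proof.
elim: s => [|phi s [m [e He]]]; first by exists 0%N, (fun=> 0) => x; exists (fun=> 0).
have [[u [us u0]]|nu] := pselect
    (exists u, (forall psi : bop X R^o, psi \in s -> psi u = 0) /\ phi u != 0).
  exists m.+1, (fun i => if i == m then u else e i) => x; have [c Hc] := He x.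
  set y := x - _ in Hc.
  exists (fun i => if i == m then phi y / phi u else c i) => psi.
  rewrite big_ord_recr/= eqxx.
  rewrite (eq_bigr (fun i : 'I_m => c i *: e i)); last first.
    by move=> i _; rewrite ltn_eqF.
  rewrite opprD addrA -/y bopB bopZ inE => /orP [/eqP ->|psis].
    by rewrite /GRing.scale/= divfK// subrr.
  by rewrite (Hc psi)// (us psi)// scaler0 subr0.
exists m, e => x; have [c Hc] := He x; exists c => psi.
rewrite inE => /orP [/eqP ->|/Hc//].
by apply: contrapT => /eqP phi0; apply: nu; exists (x - \sum_(i < m) c i *: e i).
Qed.

Lemma common_kernel (s : seq (bop X R^o)) : @infinite_dimensional R X ->
  exists2 x, x != 0 & forall phi : bop X R^o, phi \in s -> phi x = 0.
Proof.
move=> Xinf; have [m [e He]] := finite_codimension s.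
have [x nx] := Xinf m (fun i => e i).
have [c Hc] := He x; exists (x - \sum_(i < m) c i *: e i) => //.
apply: contra_notN nx; rewrite subr_eq0 => /eqP ->.
by exists (fun i => c i).
Qed.

Lemma triangular_system : @infinite_dimensional R X ->
  exists (e : nat -> X) (l : nat -> bop X R^o),
  [/\ forall n, `|e n| = 1, forall n y, `|l n y| <= `|y|,
      forall n, l n (e n) = 1 & forall m n, (m < n)%N -> l m (e n) = 0].
Proof.
move=> Xinf.
have step (s : seq (bop X R^o)) : exists u : X * bop X R^o,
    [/\ `|u.1| = 1, forall y, `|u.2 y| <= `|y|, u.2 u.1 = 1 &
     forall phi : bop X R^o, phi \in s -> phi u.1 = 0].
  have [x x0 xs] := common_kernel s Xinf; have nx0 : `|x| != 0 by rewrite normr_eq0.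
  have [phi [phi1 phix]] := norming_functional (`|x|^-1 *: x).
  have n1 : `| `|x|^-1 *: x | = 1 by rewrite normrZ normfV normr_id mulVf.
  exists (`|x|^-1 *: x, phi); split=> //=; first by rewrite phix.
  by move=> psi psis; rewrite bopZ xs// scaler0.
have [F HF] := choice step.
(* [L n] lists the functionals chosen before stage [n]. The next vector lies in their common kernel,
   and its norming functional joins the list. *)
pose L := fix L n := if n is n'.+1 then (F (L n')).2 :: L n' else [::].
exists (fun n => (F (L n)).1), (fun n => (F (L n)).2); split.
- by move=> n; have [] := HF (L n).
- by move=> n; have [] := HF (L n).
- by move=> n; have [] := HF (L n).
- move=> m n mn; have [_ _ _] := HF (L n); apply.
  elim: n mn => // n IH; rewrite ltnS leq_eqVlt /= inE => /orP [/eqP ->|/IH ->].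
    by rewrite eqxx.
  by rewrite orbT.
Qed.

End TriangularSystem.

(** * Locally finite sums *)

Section LocallyFiniteSum.
Context {R : realType}.

(* The sum of an eventually zero family (the empty sum for other families). *)
Definition lsum (W : zmodType) (u : nat -> W) : W :=
  \sum_(0 <= n < xget 0%N [set K | forall n, (K <= n)%N -> u n = 0]) u n.

Lemma lsumE (W : zmodType) (u : nat -> W) K :
  (forall n, (K <= n)%N -> u n = 0) -> lsum u = \sum_(0 <= n < K) u n.
Proof.
rewrite /lsum => HK; set L := xget _ _.
have HL n : (L <= n)%N -> u n = 0.
  by have := @xgetI _ 0%N [set K | forall n, (K <= n)%N -> u n = 0] K HK; apply.
wlog LK : K L HK HL / (L <= K)%N.
  move=> H; have [|/ltnW] := leqP L K; first exact: H.
  by move=> KL; apply/esym; exact: H.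
rewrite (big_cat_nat (n := L) (p := K))//= (_ : \sum_(L <= i < K) u i = 0) ?addr0//.
by rewrite big_nat big1 // => i /andP [/HL].
Qed.

Lemma Ck_lsum (X W : normedModType R) n (u : nat -> X -> W) x :
  (exists K, \forall y \near x, forall i, (K <= i)%N -> u i y = 0) ->
  (forall i, Ck n (u i) x) -> Ck n (fun y => lsum (u^~ y)) x.
Proof.
move=> [K uK] uC; apply: Ck_near_eq (Ck_sum (index_iota 0 K) uC).
by apply: filterS uK => y uy; rewrite (lsumE uy).
Qed.

End LocallyFiniteSum.

(** * A bump from a diffeomorphism *)

Section BumpOfDiffeomorphism.
Context {R : realType} {X : normedModType R}.

Lemma bump_of_diffeo p (D : set X) (f : X -> X) :
  D !=set0 -> (forall x, ~ D (f x)) -> (forall x, 1 < `|x| -> f x = x) ->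
  Cp_on p setT f -> @has_Cp_bump R X p.
Proof.
move=> [d Dd] Df f1 fC.
have fd : f d - d != 0.
  by rewrite subr_eq0; apply/eqP => fd; apply: (Df d); rewrite fd.
have [phi [_ phid]] := norming_functional (f d - d).
exists (fun x => phi (f x - x)); split; last first.
  apply: Cp_on_of_Ck => n x np _.
  apply: Ck_comp (Ck_bop _ _ _); apply: CkB (Ck_id _ _).
  exact: Ck_of_Cp openT fC np _.
split; first by exists d; rewrite phid normr_eq0.
exists 1 => x sx; rewrite leNgt; apply/negP => x1.
(* The ball of this radius about [x] misses the unit ball, so the function vanishes on it and [x] is
   not in the closure. *)
have x10 : 0 < `|x| - 1 by rewrite subr_gt0.
have [y [/= /negP by0 yx]] := sx _ (near_dist x x10); apply: by0.
rewrite f1 ?subrr ?bop0//.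
have := lerB_dist x y; rewrite distrC; lra.
Qed.

End BumpOfDiffeomorphism.

(** * Deleting a ray *)

Lemma exists_nat_gt (R : realType) (x : R) : exists n : nat, x < n%:R.
Proof. by exists (Num.truncn x).+1; exact: truncnS_gt. Qed.

Section PushAlongRay.
Context {R : realType} {X : normedModType R}.
Variables (l : bop X R^o) (v : X) (b : X -> R^o) (eps : R) (p : option nat).
Hypothesis lv : l v = 1.
Hypothesis b_ge0 : forall x, 0 <= b x.
Hypothesis b0 : b 0 = 1.
Hypothesis eps_gt0 : 0 < eps.
Hypothesis b_eps : forall x, eps <= `|x| -> b x = 0.
Hypothesis bC : forall n x, ord_le n p -> Ck n b x.

Definition proj w := w - l w *: v.

Lemma l_proj w : l (proj w) = 0.
Proof. by rewrite /proj bopB bopZ lv [_ *: 1]mulr1 subrr. Qed.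

Lemma l_addv w (s : R) : l (w + s *: v) = l w + s.
Proof. by rewrite bopD bopZ lv [_ *: 1]mulr1. Qed.

Lemma proj_addv w (s : R) : proj (w + s *: v) = proj w.
Proof. by rewrite /proj l_addv scalerDl opprD addrACA subrr addr0. Qed.

Lemma Ck_proj n w : Ck n proj w.
Proof. by apply: CkB (Ck_id _ _) (CkZ (Ck_bop _ _ _) (Ck_cst _ _ _)). Qed.

(* The complement of the half-line [1, +oo[ v. *)
Definition slit : set X := [set w | l w < 1 \/ proj w != 0].

Lemma slit_near w : slit w -> \forall y \near w, slit y.
Proof.
move=> [lw|pw].
  near=> y; left; near: y.
  have /cvgrPdist_lt := Ck_cvg (Ck_bop 0 l w).
  move=> /(_ (1 - l w)); rewrite subr_gt0 => /(_ lw); apply: filterS => y.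
  by rewrite distrC => /(le_lt_trans (ler_norm _)); rewrite ltrD2r.
near=> y; right; near: y.
have /cvgrPdist_lt := Ck_cvg (Ck_proj 0 w).
move=> /(_ `|proj w|); rewrite normr_gt0 => /(_ pw); apply: filterS => y.
by apply: contraTneq => ->; rewrite subr0 ltxx.
Unshelve. all: by end_near. Qed.

(** Starting at [1/2] makes every push term vanish where [l w <= 1/2]. *)
Definition offset n : R := n.+2%:R^-1.

Lemma offset_gt0 n : 0 < offset n.
Proof. by rewrite invr_gt0. Qed.

Lemma offset_le n : offset n <= 2^-1.
Proof. by rewrite lef_pV2 ?posrE// ler_nat. Qed.

(* Chosen so that the [n]-th push term is [n.+1] at [(1 - offset n / 2) v]. *)
Definition height n : R := n.+1%:R / flat 0 (offset n / 2).

Lemma height_gt0 n : 0 < height n.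
Proof. by rewrite divr_gt0// flat0_gt0// divr_gt0// offset_gt0. Qed.

Definition push_term n w : R :=
  b (n.+1%:R *: proj w) * (height n * flat 0 (l w - 1 + offset n)).

Definition push w : R^o := lsum (push_term^~ w).

Lemma push_term_ge0 n w : 0 <= push_term n w.
Proof. by rewrite /push_term mulr_ge0 ?b_ge0// mulr_ge0 ?flat_ge0// (ltW (height_gt0 n)). Qed.

Lemma push_term_far n w : eps <= n.+1%:R * `|proj w| -> push_term n w = 0.
Proof. by move=> H; rewrite /push_term b_eps ?mul0r// normrZ ger0_norm. Qed.

Lemma push_term_low n w : l w <= 1 - offset n -> push_term n w = 0.
Proof. by move=> H; rewrite /push_term flat_le0 ?mulr0//; lra. Qed.

Lemma push_locally_finite w : slit w ->
  exists K, \forall y \near w, forall n, (K <= n)%N -> push_term n y = 0.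
Proof.
move=> [lw|pw].
  pose d := (1 - l w) / 2; have d0 : 0 < d by rewrite divr_gt0// subr_gt0.
  have [K HK] := exists_nat_gt d^-1; exists K.
  have /cvgrPdist_lt /(_ _ d0) := Ck_cvg (Ck_bop 0 l w); apply: filterS => y.
  rewrite distrC => /(le_lt_trans (ler_norm _)) yw n Kn; apply: push_term_low.
  have : offset n <= d.
    rewrite -[d]invrK lef_pV2 ?posrE ?invr_gt0// (le_trans (ltW HK))// ler_nat.
    by rewrite (leq_trans Kn)// ltnW.
  rewrite /d in yw *; lra.
pose r := `|proj w| / 2.
have r0 : 0 < r by rewrite divr_gt0// normr_gt0.
have [K HK] := exists_nat_gt (eps / r); exists K.
have /cvgrPdist_lt /(_ _ r0) := Ck_cvg (Ck_proj 0 w); apply: filterS => y yw n Kn.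
have ry : r <= `|proj y|.
  have := lerB_dist (proj w) (proj y); rewrite /r in yw *; lra.
apply: push_term_far; rewrite ltr_pdivrMr// in HK.
rewrite (le_trans (ltW HK))// ler_pM ?(ltW r0)// ler_nat.
exact: leqW.
Qed.

Lemma Ck_push n w : ord_le n p -> slit w -> Ck n push w.
Proof.
move=> np /push_locally_finite sw; apply: Ck_lsum sw _ => i.
apply: CkM.
  apply: Ck_comp (bC _ np).
  by apply: CkZ (Ck_cst _ _ _) (Ck_proj _ _).
apply: CkM (Ck_cst _ _ _) _.
apply: (Ck_comp (f := fun w => l w - 1 + offset i : R^o)) (Ck_flat _ _ _).
by apply: CkD (Ck_cst _ _ _); apply: CkB (Ck_bop _ _ _) (Ck_cst _ _ _).
Qed.

Lemma pushE w : slit w ->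
  exists K, forall L, (K <= L)%N -> push w = \sum_(0 <= n < L) push_term n w.
Proof.
move=> /push_locally_finite [K /nbhs_singleton HK]; exists K => L KL.
by rewrite /push (lsumE (K := L))// => n Ln; rewrite HK// (leq_trans KL).
Qed.

Lemma push_ge0 w : 0 <= push w.
Proof. by apply: sumr_ge0 => n _; exact: push_term_ge0. Qed.

Lemma push_mono w (s : R) : 0 <= s -> slit w -> slit (w + s *: v) ->
  push w <= push (w + s *: v).
Proof.
move=> s0 /pushE [K HK] /pushE [L HL].
rewrite (HK (maxn K L)) ?leq_maxl// (HL (maxn K L)) ?leq_maxr//.
apply: ler_sum => n _; rewrite /push_term proj_addv l_addv.
rewrite ler_wpM2l ?b_ge0// ler_wpM2l ?(ltW (height_gt0 _))//.
by apply: flat0_nondecreasing; lra.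
Qed.

Lemma push_low w : l w <= 2^-1 -> push w = 0.
Proof.
move=> lw; rewrite /push /lsum big1// => n _; apply: push_term_low.
by have := offset_le n; lra.
Qed.

Lemma push_far w : eps <= `|proj w| -> push w = 0.
Proof.
move=> lw; rewrite /push /lsum big1// => n _; apply: push_term_far.
by rewrite (le_trans lw)// ler_peMl// ler1n.
Qed.

(** On the axis [b] equals [1] and the [n]-th term alone is [n + 1]. Thus [push] is unbounded along
    the axis below the level [1]. *)
Lemma push_axis n w : proj w = 0 -> l w = 1 - offset n / 2 -> n.+1%:R <= push w.
Proof.
move=> pw lw; have o0 := offset_gt0 n.
have [|K HK] := @pushE w; first by left; lra.
rewrite (HK (maxn K n.+1)) ?leq_maxl//.
rewrite (bigD1_seq n) ?iota_uniq ?mem_index_iota ?leq_maxr//=.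
rewrite (_ : push_term n w = n.+1%:R).
  by rewrite lerDl sumr_ge0// => i _; exact: push_term_ge0.
rewrite /push_term pw scaler0 b0 mul1r lw.
rewrite (_ : _ + _ = offset n / 2); last by lra.
by rewrite divfK// gt_eqF// flat0_gt0// divr_gt0.
Qed.

(** Follows from monotonicity along [v]. Where [push] is not differentiable, [der] is [0] by
    default. *)
Lemma der_push_ge0 w : slit w -> 0 <= der push w v.
Proof.
move=> sw; have [[A pA]|nA] := pselect (exists A, fder push w A); last first.
  rewrite (_ : der push w = 0) ?bopE//.
  by rewrite /der xgetPN// => A pA; apply: nA; exists A.
have v0 : 0 < `|v|.
  by rewrite normr_gt0; apply/eqP => v0; move: lv; rewrite v0 bop0 => /esym/eqP; rewrite oner_eq0.
rewrite (der_eq pA) leNgt; apply/negP => Av.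
(* With this [e] the error at the step [s *: v] is half of [- A v * s], so a negative [A v] would
   make [push] decrease. *)
pose e := - A v / (2 * `|v|).
have e0 : 0 < e by rewrite divr_gt0 ?mulr_gt0// oppr_gt0.
have [d d0 Hd] := near_normP (pA _ e0).
have [d' d'0 Hd'] := near_normP (slit_near sw).
pose s := Num.min d d' / (2 * `|v|).
have m0 : 0 < Num.min d d' by rewrite lt_min d0.
have s0 : 0 < s by rewrite divr_gt0// mulr_gt0.
have sv : `|w + s *: v - w| < Num.min d d'.
  rewrite addrAC subrr add0r normrZ gtr0_norm// /s invfM mulrA mulfVK ?gt_eqF//.
  by rewrite ltr_pdivrMr// ltr_pMr// ltr1n.
move: sv; rewrite lt_min => /andP [/Hd H1 /Hd' H2].
have := push_mono (ltW s0) sw H2; move: H1.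
rewrite (addrAC w) subrr add0r bopZ normrZ (gtr0_norm s0) /GRing.scale/= => H1 H3.
have := le_trans (ler_norm _) H1.
have -> : e * (s * `|v|) = - A v * s / 2.
  by rewrite /e; field; rewrite gt_eqF.
have : A v * s < 0 by rewrite pmulr_llt0.
lra.
Qed.

Lemma ord_le0 : ord_le 0 p. Proof. by case: p. Qed.

Lemma push_continuous w : slit w -> push y @[y --> w] --> push w.
Proof. by move=> sw; exact: (Ck_push ord_le0 sw). Qed.

(** In terms of the level [s = l w - q] on the line through [w] along [v], the equation reads
    [s + push (y s) = l w]. It is solved by the intermediate value theorem. *)
Lemma push_root_exists w : 0 < l w ->
  exists q : R, [/\ 0 < l (w - q *: v), slit (w - q *: v) & q = push (w - q *: v)].
Proof.
move=> lw; pose y s := w + (s - l w) *: v.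
have ly s : l (y s) = s by rewrite l_addv addrC subrK.
have py s : proj (y s) = proj w by exact: proj_addv.
pose a := Num.min (l w) 2^-1.
have a0 : 0 < a by rewrite lt_min lw invr_gt0 ltr0n.
have aw : a <= l w by rewrite ge_min lexx.
have a2 : a <= 2^-1 by rewrite ge_min lexx orbT.
(* The upper end: off the axis the level [l w] already works. On the axis the blow-up of [push]
   provides a level below [1], so the segment stays in [slit]. *)
have [c [ac cw cs]] : exists c, [/\ a <= c, l w <= c + push (y c) &
    forall s, s <= c -> slit (y s)].
  have [pw|pw] := eqVneq (proj w) 0; last first.
    exists (l w); split=> //; first by rewrite lerDl push_ge0.
    by move=> s _; right; rewrite py.
  have [n Hn] := exists_nat_gt (l w).
  have on := offset_le n; have o0 := offset_gt0 n.
  exists (1 - offset n / 2); split; first by lra.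
    have H := @push_axis n (y (1 - offset n / 2)).
    rewrite py ly in H; have {H} := H pw erefl.
    have : n%:R <= n.+1%:R :> R by rewrite ler_nat.
    by lra.
  by move=> s sc; left; rewrite ly; lra.
pose F s := s + push (y s).
have FE s : F s = s + push (y s) by [].
have Fc : {in `[a, c], continuous F}.
  move=> s; rewrite in_itv/= => /andP [_ sc].
  have yC : Ck 0 (y : R^o -> X) s.
    apply: CkD (Ck_cst _ _ _) (CkZ _ (Ck_cst _ _ _)).
    by apply: CkB (Ck_id _ _) (Ck_cst _ _ _).
  exact: (CkD (Ck_id 0 (s : R^o)) (Ck_comp yC (Ck_push ord_le0 (cs _ sc)))).
have Fa : F a = a by rewrite FE push_low ?addr0// ly.
have Fw : {within `[a, c], continuous F}.
  by apply: continuous_in_subspaceT => s; rewrite inE => /Fc.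
have mid : Num.min (F a) (F c) <= l w <= Num.max (F a) (F c).
  by rewrite Fa ge_min aw le_max cw orbT.
have [s] := IVT ac Fw mid.
rewrite in_itv/= => /andP [as_ sc] Fs.
exists (l w - s); rewrite -scaleNr opprB -/(y s) ly; split.
- exact: lt_le_trans as_.
- exact: cs.
- by rewrite -Fs FE addrC addKr.
Qed.

Lemma slit_between w (s t : R) : s <= t -> slit (w - s *: v) -> slit (w - t *: v).
Proof.
rewrite /slit /= -!scaleNr !proj_addv !l_addv => st [ls|]; last by right.
by left; lra.
Qed.

Lemma push_antitone w (s t : R) : s <= t -> slit (w - s *: v) ->
  push (w - t *: v) <= push (w - s *: v).
Proof.
move=> st ss; have E : w - s *: v = w - t *: v + (t - s) *: v.
  by rewrite -!scaleNr -addrA -scalerDl addKr.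
rewrite E; apply: push_mono; rewrite -?E ?subr_ge0//.
exact: slit_between ss.
Qed.

(** The point [w - root w *: v] is the preimage of [w] under adding [push] times [v]. For [l w <= 0]
    no such number exists, because [push >= 0]. *)
Definition root w : R^o :=
  xget 0 [set q : R | [/\ 0 < l (w - q *: v), slit (w - q *: v) & q = push (w - q *: v)]].

Lemma rootP w : 0 < l w ->
  [/\ 0 < l (w - root w *: v), slit (w - root w *: v) &
      root w = push (w - root w *: v)].
Proof.
move=> /push_root_exists [q Hq].
exact: (@xgetI _ 0 [set q : R | [/\ 0 < l (w - q *: v), slit (w - q *: v) &
  q = push (w - q *: v)]] q).
Qed.

(** [push (w - q *: v)] is nonincreasing in [q], so it has at most one fixed point. *)
Lemma root_unique w (q r : R) : slit (w - q *: v) -> slit (w - r *: v) ->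
  q = push (w - q *: v) -> r = push (w - r *: v) -> q = r.
Proof.
move=> sq sr qE rE; have [qr|rq|//] := ltgtP q r.
  by have := push_antitone (ltW qr) sq; rewrite -qE -rE; lra.
by have := push_antitone (ltW rq) sr; rewrite -qE -rE; lra.
Qed.

(** The strict inequalities between [push] and the candidates [q - d] and [q + d] persist near [w].
    Monotonicity then traps the root between them. *)
Lemma root_continuous w : 0 < l w -> root y @[y --> w] --> root w.
Proof.
move=> lw; have [lr sr rE] := rootP lw; apply/cvgrPdist_lt => e e0.
set q := root w in lr sr rE *.
have ldn (t : R) : l (w - (q + t) *: v) = l (w - q *: v) - t.
  by rewrite scalerDl opprD addrA -(scaleNr t) l_addv.
(* Lowering the candidate root raises the point towards the half-line, so [d] must be small for
   [q - d]. Membership in [slit] for [q + d] is then automatic by [slit_between]. *)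
have [d [d0 de dl ds]] : exists d : R, [/\ 0 < d, d <= e,
    0 < l (w - (q + d) *: v) & slit (w - (q - d) *: v)].
  pose d0 := Num.min e (l (w - q *: v) / 2).
  have d00 : 0 < d0 by rewrite lt_min e0 divr_gt0.
  have d0e : d0 <= e by rewrite ge_min lexx.
  have d0l : d0 <= l (w - q *: v) / 2 by rewrite ge_min lexx orbT.
  case: sr => [sr|sr].
    pose d := Num.min d0 ((1 - l (w - q *: v)) / 2).
    have dd0 : d <= d0 by rewrite ge_min lexx.
    have d1 : d <= (1 - l (w - q *: v)) / 2 by rewrite ge_min lexx orbT.
    exists d; split; first by rewrite lt_min d00 divr_gt0// subr_gt0.
    - exact: le_trans dd0 d0e.
    - by rewrite ldn; lra.
    - by left; rewrite (ldn (- d)); lra.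
  exists d0; split=> //; first by rewrite ldn; lra.
  by right; rewrite -!scaleNr !proj_addv in sr *.
have sd : slit (w - (q + d) *: v) by apply: slit_between sr; lra.
have up : push (w - (q + d) *: v) < q + d.
  have := @push_antitone w q (q + d); rewrite -rE => H.
  by rewrite (le_lt_trans (H _ sr))//; lra.
have dn : q - d < push (w - (q - d) *: v).
  have := @push_antitone w (q - d) q; rewrite -rE => H.
  by rewrite (lt_le_trans _ (H _ ds))//; lra.
have shift (t : R) : w' - t *: v @[w' --> w] --> w - t *: v.
  by apply: cvgB; [exact: cvg_id | exact: cvg_cst].
have up' := cvg_comp _ _ (shift (q + d)) (push_continuous sd).
have dn' := cvg_comp _ _ (shift (q - d)) (push_continuous ds).
have sdn := shift (q - d) _ (slit_near ds).
have lC := Ck_cvg (Ck_bop 0 l w).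
near=> w'.
have lw' : 0 < l w' by near: w'; apply: (cvgr_gt _ lC).
have up1 : push (w' - (q + d) *: v) < q + d by near: w'; apply: (cvgr_lt _ up').
have dn1 : q - d < push (w' - (q - d) *: v) by near: w'; apply: (cvgr_gt _ dn').
have s1 : slit (w' - (q - d) *: v) by near: w'; exact: sdn.
have := rootP lw'; move: (root w') => q' [_ s' rE'].
rewrite (lt_le_trans _ de)// ltr_distlC; apply/andP; split.
  rewrite ltNge; apply/negP => H; have := push_antitone H s'; rewrite -rE' => H'.
  by have := lt_le_trans dn1 H'; rewrite ltNge H.
rewrite ltNge; apply/negP => H.
have s2 : slit (w' - (q + d) *: v) by apply: slit_between s1; lra.
have := push_antitone H s2; rewrite -rE' => H'.
by have := le_lt_trans H' up1; rewrite ltNge H.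
Unshelve. all: by end_near. Qed.

Lemma Ck_root n w : ord_le n p -> 0 < l w -> Ck n root w.
Proof.
move=> np lw; have [lr sr _] := rootP lw.
have lC := Ck_cvg (Ck_bop 0 l w).
have near_l : \forall y \near w, 0 < l y by exact: (cvgr_gt _ lC).
apply: (Ck_implicit (N := push) (v := v)).
- by apply: filterS near_l => y; exact: root_continuous.
- by apply: filterS near_l => y /rootP [].
- by apply: filterS (slit_near sr) => y; exact: der_push_ge0.
- exact: Ck_push.
Qed.

(** * Bending the half-line into the deleted ray *)

Variable gam : R^o -> X.
Hypothesis gamC : forall n (t : R^o), 0 < t -> Ck n gam t.
Hypothesis l_gam : forall t, l (gam t) = 0.
Hypothesis gam_sep : forall s t : R, 0 < s -> s + 2 <= t ->
  5 * eps <= `|gam t - gam s|.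
Hypothesis gam_ball : forall t : R, 0 < t -> 2 * `|v| + `|gam t| + eps <= 1.

Lemma proj_id y : l y = 0 -> proj y = y.
Proof. by move=> ly; rewrite /proj ly scale0r subr0. Qed.

Lemma projK y : proj y + l y *: v = y.
Proof. by rewrite subrK. Qed.

(** Levels are inverted, so the hyperplane [l = 0] corresponds to the far end of the half-line. *)
Definition straighten x := proj x - gam (l x)^-1 + (l x)^-1 *: v.
Definition bend w := proj w + gam (l w) + (l w)^-1 *: v.

Lemma l_straighten x : l (straighten x) = (l x)^-1.
Proof. by rewrite l_addv bopB l_proj l_gam subr0 add0r. Qed.

Lemma proj_straighten x : proj (straighten x) = proj x - gam (l x)^-1.
Proof. by rewrite proj_addv proj_id// bopB l_proj l_gam subr0. Qed.

Lemma l_bend w : l (bend w) = (l w)^-1.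
Proof. by rewrite l_addv bopD l_proj l_gam addr0 add0r. Qed.

Lemma proj_bend w : proj (bend w) = proj w + gam (l w).
Proof. by rewrite proj_addv proj_id// bopD l_proj l_gam addr0. Qed.

Lemma straightenK x : bend (straighten x) = x.
Proof. by rewrite /bend l_straighten proj_straighten invrK subrK projK. Qed.

Lemma bendK w : straighten (bend w) = w.
Proof. by rewrite /straighten l_bend proj_bend invrK addrK projK. Qed.

Lemma Ck_straighten n x : 0 < l x -> Ck n straighten x.
Proof.
move=> lx; have iC : Ck n (fun x => (l x)^-1 : R^o) x.
  by apply: Ck_inv (Ck_bop _ _ _); rewrite gt_eqF.
apply: CkD (CkZ iC (Ck_cst _ _ _)); apply: CkB (Ck_proj _ _) _.
by apply: Ck_comp iC (gamC _ _); rewrite invr_gt0.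
Qed.

Lemma Ck_bend n w : 0 < l w -> Ck n bend w.
Proof.
move=> lw; apply: CkD; last first.
  by apply: CkZ (Ck_cst _ _ _); apply: Ck_inv (Ck_bop _ _ _); rewrite gt_eqF.
by apply: CkD (Ck_proj _ _) _; exact: Ck_comp (Ck_bop _ _ _) (gamC _ _).
Qed.

Definition ray : set X := [set x | 0 < l x /\ ~ slit (straighten x)].

Definition delete_ray x : X :=
  if 0 < l x then bend (straighten x - root (straighten x) *: v) else x.

Definition fill_ray x : X :=
  if 0 < l x then bend (straighten x + push (straighten x) *: v) else x.

Lemma straighten_gt0 x : 0 < l x -> 0 < l (straighten x).
Proof. by rewrite l_straighten invr_gt0. Qed.

Lemma delete_ray_notin x : ~ ray (delete_ray x).
Proof.
rewrite /delete_ray; case: ifPn => [lx|lx]; last by case; rewrite (negbTE lx).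
by have [_ sx _] := rootP (straighten_gt0 lx); case=> _; rewrite bendK.
Qed.

Lemma delete_rayK x : fill_ray (delete_ray x) = x.
Proof.
rewrite /delete_ray; case: ifPn => [lx|lx]; last by rewrite /fill_ray (negbTE lx).
have [l1 sx E] := rootP (straighten_gt0 lx).
by rewrite /fill_ray l_bend invr_gt0 l1 bendK -E subrK straightenK.
Qed.

Lemma fill_rayK x : ~ ray x -> delete_ray (fill_ray x) = x.
Proof.
rewrite /fill_ray => nx; case: ifPn => [lx|lx]; last by rewrite /delete_ray (negbTE lx).
have sx : slit (straighten x) by apply: contrapT => ns; apply: nx.
set w := straighten x; have lw : 0 < l w by exact: straighten_gt0.
have lw' : 0 < l (w + push w *: v) by rewrite l_addv ltr_wpDr// push_ge0.
rewrite /delete_ray l_bend invr_gt0 lw' bendK.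
have [_ s1 E1] := rootP lw'.
have Ew : w + push w *: v - push w *: v = w by rewrite addrK.
rewrite (root_unique s1 _ E1 (r := push w)) ?Ew//.
exact: straightenK.
Qed.

(* Only parameters [t = (l y)^-1] that are large matter near [l = 0], and there
   [gam t] stays away from any given point by [gam_sep]. *)
Lemma tube_away x : l x <= 0 ->
  \forall y \near x, 0 < l y -> eps <= `|proj (straighten y)|.
Proof.
move=> lx.
have [T [T0 HT]] : exists T : R, 0 < T /\
    forall t, T <= t -> 2 * eps <= `|proj x - gam t|.
  (* If some [gam s] is within [2 * eps] of [proj x], the separation [5 * eps] keeps [gam t] more
     than [3 * eps] away for [t >= s + 2]. If none is, any threshold works. *)
  have [[s [s0 Hs]]|nos] :=
      pselect (exists s : R, 0 < s /\ `|proj x - gam s| < 2 * eps).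
    exists (s + 2); split=> [|t st]; first by rewrite addr_gt0.
    have H := gam_sep s0 st.
    have := ler_distD (proj x) (gam t) (gam s).
    by rewrite (distrC (gam t) (proj x)); have := eps_gt0; lra.
  exists 1; split=> // t t1; rewrite leNgt; apply/negP => Ht; apply: nos.
  by exists t; split=> //; rewrite (lt_le_trans _ t1).
have lC := Ck_cvg (Ck_bop 0 l x); have pC := Ck_cvg (Ck_proj 0 x).
near=> y; rewrite proj_straighten => ly.
have H1 : l y < T^-1.
  near: y; apply: (cvgr_lt _ lC).
  by rewrite (le_lt_trans lx)// invr_gt0.
have H2 : `|proj x - proj y| < eps.
  by near: y; move/cvgrPdist_lt : pC; apply.
have := HT (l y)^-1; rewrite -[X in X <= _ -> _]invrK lef_pV2 ?posrE ?invr_gt0//.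
move=> /(_ (ltW H1)).
have := ler_distD (proj y) (proj x) (gam (l y)^-1); lra.
Unshelve. all: by end_near. Qed.

Lemma root_far w : 0 < l w -> eps <= `|proj w| -> root w = 0.
Proof.
move=> lw pw; have [_ _ ->] := rootP lw.
by rewrite push_far// -scaleNr proj_addv.
Qed.

Lemma delete_ray_far x : (0 < l x -> eps <= `|proj (straighten x)|) ->
  delete_ray x = x.
Proof.
rewrite /delete_ray; case: ifP => // lx /(_ isT) H.
by rewrite root_far ?straighten_gt0// scale0r subr0 straightenK.
Qed.

Lemma fill_ray_far x : (0 < l x -> eps <= `|proj (straighten x)|) ->
  fill_ray x = x.
Proof.
rewrite /fill_ray; case: ifP => // lx /(_ isT) H.
by rewrite push_far// scale0r addr0 straightenK.
Qed.

Lemma ray_far x : (0 < l x -> eps <= `|proj (straighten x)|) -> ~ ray x.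
Proof.
move=> H [lx nx]; apply: nx; right; rewrite -normr_gt0.
by rewrite (lt_le_trans _ (H lx)).
Qed.

(** The level [2] is the reciprocal of the [1/2] in [push_low]: at higher levels nothing moves, and
    up to it [gam_ball] bounds the norm. *)
Lemma tube_ball x : 0 < l x -> l x <= 2 -> `|proj (straighten x)| <= eps ->
  `|x| <= 1.
Proof.
move=> lx lx2 px; rewrite -(straightenK x) /bend l_straighten invrK.
have H : 2 * `|v| + `|gam (l x)^-1| + eps <= 1 by apply: gam_ball; rewrite invr_gt0.
rewrite (le_trans (ler_normD _ _))// normrZ gtr0_norm//.
have H1 := ler_normD (proj (straighten x)) (gam (l x)^-1).
have H2 : l x * `|v| <= 2 * `|v| by rewrite ler_wpM2r.
lra.
Qed.

Lemma delete_ray_id x : 1 < `|x| -> delete_ray x = x.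
Proof.
move=> x1; rewrite /delete_ray; case: ifP => // lx.
have lw := straighten_gt0 lx; set w := straighten x in lw *.
suff -> : root w = 0 by rewrite scale0r subr0 straightenK.
have [_ _ E] := rootP lw.
have [|pw] := leP eps `|proj w|; first exact: root_far.
have [lw2|lw2] := leP (l w) 2^-1.
  rewrite E push_low// -scaleNr l_addv.
  by have := push_ge0 (w - root w *: v); rewrite -E; lra.
exfalso; move: x1; rewrite ltNge => /negP; apply; apply: (tube_ball lx) (ltW pw).
by move: lw2; rewrite l_straighten ltf_pV2 ?posrE// => /ltW.
Qed.

Lemma ray_ball x : ray x -> `|x| <= 1.
Proof.
move=> [lx nx]; apply: tube_ball => //.
  rewrite leNgt; apply/negP => l2; apply: nx; left.
  by rewrite l_straighten invf_lt1// (lt_trans _ l2)// ltr1n.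
rewrite leNgt; apply/negP => pe; apply: nx; right.
by rewrite -normr_gt0 (lt_trans _ pe).
Qed.

(** Where [l x <= 0], [tube_away] makes the map the identity near [x], so the two branches of the
    definition fit together. Elsewhere it is a composition of smooth maps. *)
Lemma Ck_delete_ray n x : ord_le n p -> Ck n delete_ray x.
Proof.
move=> np; have [lx|lx] := ltP 0 (l x); last first.
  apply: Ck_near_eq (Ck_id n x); apply: filterS (tube_away lx) => y H.
  by rewrite delete_ray_far.
have lC := Ck_cvg (Ck_bop 0 l x).
have near_l : \forall y \near x, 0 < l y by exact: (cvgr_gt _ lC).
apply: (Ck_near_eq (f := fun x => bend (straighten x - root (straighten x) *: v))).
  by apply: filterS near_l => y ly; rewrite /delete_ray ly.
have [l1 _ _] := rootP (straighten_gt0 lx).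
apply: (Ck_comp (f := fun y => straighten y - root (straighten y) *: v) _ (Ck_bend n l1)).
apply: CkB (Ck_straighten n lx) _.
apply: CkZ (Ck_cst _ _ _); apply: Ck_comp (Ck_straighten n lx) _.
by apply: Ck_root => //; exact: straighten_gt0.
Qed.

Lemma Ck_fill_ray n x : ord_le n p -> ~ ray x -> Ck n fill_ray x.
Proof.
move=> np nx; have [lx|lx] := ltP 0 (l x); last first.
  apply: Ck_near_eq (Ck_id n x); apply: filterS (tube_away lx) => y H.
  by rewrite fill_ray_far.
have lC := Ck_cvg (Ck_bop 0 l x).
have near_l : \forall y \near x, 0 < l y by exact: (cvgr_gt _ lC).
apply: (Ck_near_eq (f := fun x => bend (straighten x + push (straighten x) *: v))).
  by apply: filterS near_l => y ly; rewrite /fill_ray ly.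
have sx : slit (straighten x) by apply: contrapT => ns; apply: nx.
have l1 : 0 < l (straighten x + push (straighten x) *: v).
  by rewrite l_addv ltr_wpDr ?push_ge0 ?straighten_gt0.
apply: (Ck_comp (f := fun y => straighten y + push (straighten y) *: v) _ (Ck_bend n l1)).
apply: CkD (Ck_straighten n lx) _.
apply: CkZ (Ck_cst _ _ _); apply: Ck_comp (Ck_straighten n lx) _.
exact: Ck_push.
Qed.

Lemma ray_closed : closed ray.
Proof.
rewrite -openC openE => x /= nx.
have [lx|lx] := ltP 0 (l x); last first.
  by apply: filterS (tube_away lx) => y; exact: ray_far.
have sx : slit (straighten x) by apply: contrapT => ns; apply: nx.
have sl : \forall y \near x, slit (straighten y).
  exact: Ck_cvg (Ck_straighten 0 lx) _ (slit_near sx).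
by apply: filterS sl => y sy [_].
Qed.

(** The ray in terms of its level [s = 1 / t]: it ends at [s = 1] and runs off as [s] tends to
    [0]. *)
Definition ray_param (s : R^o) : X := gam s^-1 + s *: v.

Lemma l_ray_param s : l (ray_param s) = s.
Proof. by rewrite l_addv l_gam add0r. Qed.

Lemma rayP x : ray x <-> [/\ 0 < l x, l x <= 1 & x = ray_param (l x)].
Proof.
split=> [[lx ns]|[lx lx1 xE]].
  have l1 : l x <= 1.
    rewrite leNgt; apply/negP => l1; apply: ns; left.
    by rewrite l_straighten invf_lt1.
  split=> //; apply: contrapT => xE; apply: ns; right; apply/eqP => p0.
  apply: xE; move: p0; rewrite proj_straighten => /eqP; rewrite subr_eq0 => /eqP p0.
  by rewrite /ray_param -p0 projK.
split=> // -[|]; first by rewrite l_straighten invf_lt1// ltNge lx1.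
by rewrite proj_straighten {1}xE proj_addv proj_id// subrr eqxx.
Qed.

Lemma Ck_ray_param n s : 0 < s -> Ck n ray_param s.
Proof.
move=> s0; apply: CkD (CkZ (Ck_id _ _) (Ck_cst _ _ _)).
apply: (Ck_comp (f := fun s : R^o => s^-1 : R^o)).
  by apply: Ck_Rinv; rewrite gt_eqF.
by apply: gamC; rewrite invr_gt0.
Qed.

(** The level is moved linearly to [1]. It stays in the half-open interval from [0] to [1], where
    [ray_param] is continuous. *)
Lemma ray_contractible : contractible ray.
Proof.
pose h (x : X) (t : R) : R := (1 - t) * l x + t.
have h01 x (t : R) : ray x -> `[0, 1]%classic t -> 0 < h x t /\ h x t <= 1.
  move=> /rayP [l0 l1 _] /=; rewrite in_itv/= => /andP [t0 t1]; rewrite /h.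
  split; last by nra.
  have [->|tn0] := eqVneq t 0; first by rewrite subr0 mul1r addr0.
  have tp : 0 < t by rewrite lt_neqAle eq_sym tn0.
  by rewrite ltr_wpDl// mulr_ge0 ?subr_ge0// ltW.
exists (ray_param 1), (fun x t => ray_param (h x t)); split.
- by apply/rayP; rewrite l_ray_param.
- apply: continuous_in_subspaceT => -[x t]; rewrite inE => -[/= rx t01].
  have [h0 _] := h01 _ _ rx t01.
  have hC : h q.1 q.2 @[q --> (x, t)] --> h x t.
    have c2 : q.2 @[q --> (x, t)] --> t by exact: cvg_snd.
    have c1 : l q.1 @[q --> (x, t)] --> l x.
      exact: (cvg_comp _ _ cvg_fst (Ck_cvg (Ck_bop 0 l x))).
    apply: (cvgD _ c2); apply: (cvgM _ c1); apply: (cvgB _ c2); exact: cvg_cst.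
  exact: (cvg_comp _ _ hC (Ck_cvg (Ck_ray_param 0 h0))).
- move=> x t rx t01; have [h0 h1] := h01 _ _ rx t01.
  by apply/rayP; rewrite l_ray_param.
- by move=> x /rayP [_ _ {2}->]; rewrite /h subr0 mul1r addr0.
- by move=> x _; rewrite /h subrr mul0r add0r.
Qed.

Lemma ray_deletion : exists (D : set X) (f : X -> X),
  [/\ D !=set0, closed D, D `<=` [set x | `|x| <= 1], contractible D
    & Cp_diffeo_onto_compl p D f /\ (forall x, 1 < `|x| -> f x = x)].
Proof.
exists ray, delete_ray; split.
- by exists (ray_param 1); apply/rayP; rewrite l_ray_param.
- exact: ray_closed.
- exact: ray_ball.
- exact: ray_contractible.
split; last exact: delete_ray_id.
split; first exact: delete_ray_notin.
  by apply: Cp_on_of_Ck => n x np _; exact: Ck_delete_ray.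
exists fill_ray; split; [exact: delete_rayK | exact: fill_rayK |].
by apply: Cp_on_of_Ck => n x np nx; exact: Ck_fill_ray.
Qed.

End PushAlongRay.

(** * The oscillating curve *)

Section OscillatingCurve.
Context {R : realType} {X : normedModType R}.
Variables (e : nat -> X) (l : nat -> bop X R^o).
Hypothesis e1 : forall n, `|e n| = 1.
Hypothesis l1 : forall n y, `|l n y| <= `|y|.
Hypothesis le1 : forall n, l n (e n) = 1.
Hypothesis le0 : forall m n, (m < n)%N -> l m (e n) = 0.

Definition hat (u : R^o) : R^o := flat 0 (1 + u) * flat 0 (1 - u).

Lemma hat_ge0 u : 0 <= hat u.
Proof. by rewrite mulr_ge0// flat_ge0. Qed.

Lemma hat_le1 u : hat u <= 1.
Proof. by rewrite mulr_ile1// ?flat_ge0 ?flat0_le1. Qed.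

Lemma hat_left u : u <= -1 -> hat u = 0.
Proof. by move=> u1; rewrite /hat flat_le0 ?mul0r//; lra. Qed.

Lemma hat_right u : 1 <= u -> hat u = 0.
Proof. by move=> u1; rewrite /hat (flat_le0 _ (x := 1 - u)) ?mulr0//; lra. Qed.

Lemma Ck_hat n u : Ck n hat u.
Proof.
apply: CkM.
  apply: (Ck_comp (f := fun u : R^o => 1 + u : R^o)) (Ck_flat _ _ _).
  by apply: CkD (Ck_cst _ _ _) (Ck_id _ _).
apply: (Ck_comp (f := fun u : R^o => 1 - u : R^o)) (Ck_flat _ _ _).
by apply: CkB (Ck_cst _ _ _) (Ck_id _ _).
Qed.

Definition hat_min : R := flat 0 1 * flat 0 2^-1.

Lemma hat_min_gt0 : 0 < hat_min.
Proof. by rewrite mulr_gt0// flat0_gt0. Qed.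

Lemma hat_min_le1 : hat_min <= 1.
Proof. by rewrite mulr_ile1// ?flat_ge0 ?flat0_le1. Qed.

(** One of [u] and [u - 1] is within [1/2] of [0]. There one factor of [hat] is at least [flat 0 1]
    and the other at least [flat 0 2^-1]. *)
Lemma hat_ge_min u : 0 <= u <= 1 -> hat_min <= hat u \/ hat_min <= hat (u - 1).
Proof.
move=> /andP [u0 u1]; have [u2|u2] := leP u 2^-1; [left | right].
  by rewrite ler_pM ?flat_ge0// flat0_nondecreasing//; lra.
by rewrite /hat_min mulrC ler_pM ?flat_ge0// flat0_nondecreasing//; lra.
Qed.

(** The vector [e 0] is left out so that the curve lies in the kernel of [l 0]. At most two summands
    are nonzero at each positive [t], so the factor [1/8] keeps the norm below [1/4]. *)
Definition wiggle (t : R^o) : X :=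
  8^-1 *: lsum (fun n => hat (t - n%:R) *: e n.+1).

Lemma Ck_wiggle n t : Ck n wiggle t.
Proof.
apply: CkZ (Ck_cst _ _ _) _.
apply: (Ck_lsum (u := fun n (t : R^o) => hat (t - n%:R) *: e n.+1)); last first.
  move=> i; apply: CkZ (Ck_cst _ _ _).
  apply: (Ck_comp (f := fun t : R^o => t - i%:R : R^o)) (Ck_hat _ _).
  by apply: CkB (Ck_id _ _) (Ck_cst _ _ _).
have [K HK] := exists_nat_gt (t + 2); exists K.
apply: filterS (near_dist t ltr01) => y yt i Ki.
have Ki' : K%:R <= i%:R :> R by rewrite ler_nat.
rewrite hat_left ?scale0r//; move: yt; rewrite ltr_norml => /andP [_ yt]; lra.
Qed.

Lemma wiggleE (t : R) N : N%:R <= t <= N.+1%:R -> wiggle t =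
  8^-1 *: (hat (t - N%:R) *: e N.+1 + hat (t - N%:R - 1) *: e N.+2).
Proof.
move=> /andP [Nt tN]; rewrite /wiggle (lsumE (K := N.+2)); last first.
  move=> n Nn; have : N.+2%:R <= n%:R :> R by rewrite ler_nat.
  rewrite -natr1 => nt; rewrite hat_left ?scale0r//; lra.
rewrite !big_nat_recr//= big_nat big1 ?add0r.
  by rewrite -[N.+1%:R]natr1 opprD addrA.
move=> n /andP [_ nN]; have : n.+1%:R <= N%:R :> R by rewrite ler_nat.
rewrite -natr1 => nt; rewrite hat_right ?scale0r//; lra.
Qed.

Lemma nat_floor (t : R) : 0 < t -> exists N : nat, N%:R <= t < N.+1%:R.
Proof. by move=> t0; exists (Num.truncn t); exact/truncn_itv/ltW. Qed.

Lemma l0_wiggle t : l 0 (wiggle t) = 0.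
Proof.
have [K HK] := exists_nat_gt (t + 1); rewrite /wiggle (lsumE (K := K)) => [|n Kn].
  rewrite bopZ; apply/eqP; rewrite scaler_eq0; apply/orP; right; apply/eqP.
  apply: (big_ind (fun y => l 0 y = 0)) => [|y z ly lz|n _].
  - exact: bop0.
  - by rewrite bopD ly lz addr0.
  - by rewrite bopZ le0// scaler0.
have : K%:R <= n%:R :> R by rewrite ler_nat.
by move=> Kn'; rewrite hat_left ?scale0r//; lra.
Qed.

Lemma norm_wiggle (t : R) : 0 < t -> `|wiggle t| <= 4^-1.
Proof.
move=> /nat_floor [N /andP [Nt /ltW tN]].
rewrite (wiggleE (N := N)) ?Nt// normrZ ger0_norm//.
have nh u k : `|hat u *: e k| <= 1.
  rewrite normrZ e1 mulr1 ger0_norm; [exact: hat_le1 | exact: hat_ge0].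
have := ler_normD (hat (t - N%:R) *: e N.+1) (hat (t - N%:R - 1) *: e N.+2).
have := nh (t - N%:R) N.+1; have := nh (t - N%:R - 1) N.+2; lra.
Qed.

(* Leading coefficients with respect to the triangular system cannot cancel. *)
Lemma wiggle_sep (s t : R) : 0 < s -> s + 2 <= t ->
  hat_min / 16 <= `|wiggle t - wiggle s|.
Proof.
move=> s0 st; have t0 : 0 < t by lra.
have [N /andP [Ns sN]] := nat_floor s0; have [M /andP [Mt tM]] := nat_floor t0.
have NM : (N.+2 <= M)%N.
  rewrite -ltnS -(ltr_nat R) (le_lt_trans _ tM)// -addn2 natrD.
  by rewrite (le_trans _ st)// lerD2r.
have {}Mt : M%:R <= t <= M.+1%:R by rewrite Mt ltW.
have {}Ns : N%:R <= s <= N.+1%:R by rewrite Ns ltW.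
rewrite (wiggleE Mt) (wiggleE Ns).
set u := s - N%:R; set w := _ - _.
have u01 : 0 <= u <= 1.
  by move: Ns; rewrite /u -natr1 subr_ge0 lerBlDl addrC.
have NM1 : (N < M)%N := ltnW NM.
have NM0 : (N <= M)%N := ltnW NM1.
(* As [M >= N + 2], the vectors in [wiggle t] have indices above [N + 2] and are invisible to
   [l N.+1] and [l N.+2]. *)
have L1 : l N.+1 w = - (8^-1 * hat u).
  rewrite /w bopB !bopZ !bopD !bopZ le1 !(le0 (m := N.+1)) ?ltnS//.
  by rewrite /GRing.scale/= !mulr0 mulr1 !addr0 mulr0 sub0r.
have L2 : l N.+2 w = - (8^-1 * (hat u * l N.+2 (e N.+1) + hat (u - 1))).
  rewrite /w bopB !bopZ !bopD !bopZ le1 (le0 (n := M.+1)) ?(le0 (n := M.+2))//.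
  by rewrite /GRing.scale/= !mulr0 mulr1 !addr0 mulr0 sub0r.
have H1 := l1 N.+1 w; have H2 := l1 N.+2 w.
have h0 := hat_ge0 u.
rewrite L1 normrN ger0_norm in H1; last exact: mulr_ge0.
rewrite L2 normrN in H2.
have H3 : `|l N.+2 (e N.+1)| <= 1 by rewrite (le_trans (l1 _ _))// e1.
have H4 : - hat u <= hat u * l N.+2 (e N.+1).
  by rewrite -[leLHS]mulrN1 ler_wpM2l//; move: H3; rewrite ler_norml => /andP [].
have H5 := le_trans (ler_norm _) H2.
have m0 := hat_min_gt0.
(* The norm of [w] is at least [hat u / 8] and at least [(hat (u - 1) - hat u) / 8]. The mean of
   these is [hat (u - 1) / 16], whence the constant [16]. *)
have [] := hat_ge_min u01; lra.
Qed.

End OscillatingCurve.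

(** * Assembly of the two implications *)

Lemma normalized_bump (R : realType) (X : normedModType R) p (eps : R) :
  0 < eps -> @has_Cp_bump R X p -> exists b : X -> R^o,
  [/\ forall x, 0 <= b x, b 0 = 1, forall x, eps <= `|x| -> b x = 0
    & forall n x, ord_le n p -> Ck n b x].
Proof.
move=> eps0 [b [[[x0 bx0] [M bM]] bC]].
(* For [|x| >= eps] this makes the norm of [x0 + k *: x] at least [|M| + 1], beyond the support.
   Squaring the quotient below makes it nonnegative. *)
pose k : R := (`|M| + `|x0| + 1) / eps.
have k0 : 0 < k by rewrite divr_gt0// ltr_wpDl// addr_ge0.
exists (fun x => (b (x0 + k *: x) / b x0) * (b (x0 + k *: x) / b x0)); split.
- by move=> x; rewrite -expr2 sqr_ge0.
- by rewrite scaler0 addr0 mulfV// mulr1.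
- move=> x ex; have [->|bx] := eqVneq (b (x0 + k *: x)) 0; first by rewrite !mul0r.
  have := bM _ (@subset_closure _ [set y | b y != 0] _ bx); have := lerB_dist (k *: x) (- x0).
  rewrite opprK (addrC _ x0) normrN normrZ gtr0_norm//.
  have : k * eps <= k * `|x| by rewrite ler_wpM2l// ltW.
  rewrite {1}/k divfK ?gt_eqF//.
  by have := ler_norm M; lra.
- move=> n x np.
  have bkC : Ck n (fun x => b (x0 + k *: x) / b x0 : R^o) x.
    apply: CkM (Ck_cst _ _ _).
    apply: (Ck_comp (f := fun x => x0 + k *: x)).
      by apply: CkD (Ck_cst _ _ _) (CkZ (Ck_cst _ _ _) (Ck_id _ _)).
    exact: Ck_of_Cp openT bC np _.
  exact: (CkM bkC bkC).
Qed.

Lemma ray_deletion_of_bump (R : realType) (X : normedModType R) p :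
  @infinite_dimensional R X -> @has_Cp_bump R X p ->
  exists (D : set X) (f : X -> X),
  [/\ D !=set0, closed D, D `<=` [set x | `|x| <= 1], contractible D
    & Cp_diffeo_onto_compl p D f /\ (forall x, 1 < `|x| -> f x = x)].
Proof.
move=> Xinf Xb; have [e [l [e1 l1 le1 le0]]] := triangular_system Xinf.
have m0 := @hat_min_gt0 R; have m1 := @hat_min_le1 R.
(* Then [5 * eps] is the separation [hat_min / 16] of [wiggle_sep]. *)
pose eps : R := hat_min / 80.
have eps0 : 0 < eps by rewrite divr_gt0.
have [b [b_ge0 b0 b_eps bC]] := normalized_bump eps0 Xb.
(* With [|v| = 1/8] and the curve bounded by [1/4], the sum in [gam_ball] is at most [1/2 + eps]. *)
pose v := 8^-1 *: e 0%N; pose L := 8 *: l 0%N.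
have Lv : L v = 1 by rewrite /L /v bopE bopZ le1 /GRing.scale/= mulr1 mulfV.
have nv : `|v| = 8^-1 by rewrite /v normrZ e1 mulr1 ger0_norm.
apply: (@ray_deletion R X L v b eps p Lv b_ge0 b0 eps0 b_eps bC (wiggle e)).
- by move=> n t _; exact: Ck_wiggle.
- by move=> t; rewrite /L bopE (l0_wiggle le0) scaler0.
- by move=> s t s0 st; have := wiggle_sep e1 l1 le1 le0 s0 st; rewrite /eps; lra.
- move=> t t0; rewrite nv; have := norm_wiggle e1 t0; rewrite /eps; lra.
Qed.

Theorem theorem1p5 (R : realType) (X : completeNormedModType R)
  (p : option nat) (hp : forall n, p = Some n -> (1 <= n)%N) :
  @infinite_dimensional R X ->
  (@has_Cp_bump R X p <->
   exists (D : set X) (f : X -> X),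
     [/\ D !=set0, closed D, D `<=` [set x | `|x| <= 1], contractible D
       & Cp_diffeo_onto_compl p D f /\ (forall x, 1 < `|x| -> f x = x)]).
Proof.
move=> Xinf; split; first exact: ray_deletion_of_bump.
move=> [D [f [D0 _ _ _ [[Df fC _] f1]]]].
exact: bump_of_diffeo D0 Df f1 fC.
Qed.
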